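(* Let $k\ge1$, $n\ge 2k+2$, let $\mathbb{K}$ be a field and let $T\subset\binom{[n]}{2}$. (1) If $T$ is $(k+1)$-free and $\mathbb{K}$ is algebraically closed, then for any generic choice of values $v\in\mathbb{K}^T$ there is at least one skew-symmetric $n\times n$ matrix over $\mathbb{K}$ of rank $\le 2k$ with the entries in the positions $T$ prescribed by $v$. (2) If $T$ contains a $k$-triangulation, then for any choice of values $v\in\mathbb{K}^T$ there is only a finite number (maybe zero) of skew-symmetric $n\times n$ matrices over $\mathbb{K}$ of rank $\le 2k$ with the entries in the positions $T$ prescribed by $v$.
   Context: Two edges $\{i,j\},\{i',j'\}\in\binom{[n]}{2}$ with $i<j$ and $i'<j'$ cross if $i<i'<j<j'$ or $i'<i<j'<j$. A $(k+1)$-crossing is a set of $k+1$ mutually crossing edges; a subset of $\binom{[n]}{2}$ is $(k+1)$-free if it contains no $(k+1)$-crossing; a $k$-triangulation is an inclusion-maximal $(k+1)$-free subset of $\binom{[n]}{2}$. Skew-symmetric matrices $M$ (with $M^t=-M$ and zero diagonal) are identified with points of $\mathbb{K}^{\binom{[n]}{2}}$ through their entries above the diagonal; the entry in position $\{i,j\}$, $i<j$, is $M_{ij}$. ''Generic'' means: for all $v$ in some nonempty Zariski-open subset of $\mathbb{K}^T$.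
   Formalization: In part (2), ''any choice of values'' is replaced by ''any generic choice of values'': as stated (2) fails over infinite fields, e.g. k=1, n=4, T all edges but one diagonal, v=0, where every matrix supported on that diagonal's positions is a completion. *)

(* Defs.v *)
From HB Require Import structures.
From mathcomp Require Import all_boot all_order all_algebra.
From mathcomp Require Import mpoly.

Set Implicit Arguments.
Unset Strict Implicit.
Unset Printing Implicit Defensive.

Import GRing.Theory.
Local Open Scope ring_scope.

(* The edge {i, j} of binom([n], 2), i < j, is encoded as the pair (i, j);   *)
(* [n] is {0, ..., n-1}.                                                      *)
Definition edge (n : nat) := {e : 'I_n * 'I_n | (e.1 < e.2)%N}.

HB.instance Definition _ n := SubFinite.on (edge n).

Definition src n (e : edge n) : 'I_n := (val e).1.
Definition tgt n (e : edge n) : 'I_n := (val e).2.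

Definition cross n (e f : edge n) : bool :=
  [&& src e < src f, src f < tgt e & tgt e < tgt f]%N
  || [&& src f < src e, src e < tgt f & tgt f < tgt e]%N.

Definition is_crossing n (m : nat) (S : {set edge n}) : bool :=
  (#|S| == m) && [forall e in S, forall f in S, (e != f) ==> cross e f].

Definition crossing_free n (m : nat) (T : {set edge n}) : bool :=
  [forall S : {set edge n}, (S \subset T) ==> ~~ is_crossing m S].

Definition k_triangulation n (k : nat) (T : {set edge n}) : bool :=
  maxset (crossing_free k.+1) T.

(* K^I, for a finite type I, is {ffun I -> K}. The variables of the          *)
(* polynomials are numbered through the enumeration of I.                     *)
Definition zariski_open (K : fieldType) (I : finType)
    (U : {ffun I -> K} -> Prop) : Prop :=
  exists S : {mpoly K[#|I|]} -> Prop,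
    forall v, U v <-> exists2 p, S p & p.@[fun i => v (enum_val i)] != 0.

Definition generically (K : fieldType) (I : finType)
    (P : {ffun I -> K} -> Prop) : Prop :=
  exists U : {ffun I -> K} -> Prop,
    [/\ zariski_open U, exists v, U v & forall v, U v -> P v].

(* The zero diagonal is not redundant in characteristic 2. *)
Definition skew_symmetric (K : fieldType) n (M : 'M[K]_n) : Prop :=
  M^T = - M /\ forall i, M i i = 0.

Definition low_rank_completion (K : fieldType) n (k : nat) (T : {set edge n})
    (v : {ffun {e : edge n | e \in T} -> K}) (M : 'M[K]_n) : Prop :=
  [/\ skew_symmetric M, (\rank M <= 2 * k)%N
    & forall e : {e : edge n | e \in T}, M (src (val e)) (tgt (val e)) = v e].

(* Finiteness of the set of completions can only be expected for generic v:  *)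
(* if k = 1, n = 4 and T omits only the edge {0, 2}, then v = 0 is completed  *)
(* by every matrix supported in the positions (0, 2) and (2, 0).              *)
Definition finitely_many (A : eqType) (P : A -> Prop) : Prop :=
  exists s : seq A, forall a, P a -> a \in s.

(* Main.v *)
Require Import Defs.
From mathcomp Require Import all_boot all_order all_algebra all_field.
From mathcomp Require Import mpoly.
From mathcomp Require Import zify ring.
From Stdlib Require Import Classical.

(* Write an edge set T as a set of pairs i < j; a (k+1)-crossing is a chain    *)
(* i_0 < ... < i_k < j_0 < ... < j_k of pairs (i_s, j_s) in T.  Everything      *)
(* rests on an operation that shortens the polygon by one vertex.  In a        *)
(* (k+1)-free T choose greedily tau_1 < ... < tau_k such that (i, tau_(i+1))   *)
(* is the first pair of T in row i after tau_i; this is the k-star at the edge *)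
(* {0, k}, and row i <= k meets no column strictly between tau_i and           *)
(* tau_(i+1).  Collapsing the star, that is merging the part of row i + 1 to   *)
(* the left of tau_(i+1) with the part of row i to its right, turns the rows   *)
(* 0, ..., k into k rows, and the result is again (k+1)-free.                  *)
(*                                                                            *)
(* Undoing the collapse shows by induction that every (k+1)-free set lies in   *)
(* a (k+1)-free set with C(n, 2) - C(n - 2k, 2) edges, so k-triangulations     *)
(* have at least that many.  As the skew-symmetric matrices of rank at most 2k *)
(* form a family with C(n, 2) - C(n - 2k, 2) parameters, any entry satisfies   *)
(* with the entries of a k-triangulation a nonzero polynomial relation, whence *)
(* part (2).                                                                  *)
(*                                                                            *)
(* For part (1), the collapse lifts to matrices: an n x n matrix is obtained   *)
(* from an (n - 1) x (n - 1) one by replacing the first k rows by combinations *)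
(* of consecutive rows with coefficients a_i t^(A_i) and t^(B_i).  If the      *)
(* orders at t = 0 of the old entries satisfy a strict Monge condition, then   *)
(* A_i and B_i can be chosen so that, at the pairs of T, the required one of   *)
(* the two rows dominates, and a_i makes the two leading coefficients at the   *)
(* column tau_(i+1) independent.  So the entries in T of a skew-symmetric      *)
(* matrix over K[t] of rank at most 2k can have any prescribed nonzero leading *)
(* coefficients, with exponents that do not depend on them; hence they are     *)
(* algebraically independent.  Quantifier elimination turns this dominance of  *)
(* the projection into the existence of completions for generic values.       *)

Set Implicit Arguments.
Unset Strict Implicit.
Unset Printing Implicit Defensive.

Import GRing.Theory.

(** * Chains and the collapse of a star *)

(** Both parts compare the skew-symmetric matrices of rank at most [2 * k] with their entries at
    [T]. Part (2) is an upper bound on independence: [low_rank_dependence] makes any more than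
    [C(n, 2) - C(n - 2k, 2)] entries algebraically dependent, [k_triangulation_card] (through
    [chain_free_extend]) shows that at least this many entries are prescribed, and
    [entry_generically_finite] makes every entry a root of a polynomial that is nonzero for generic
    [v]. Part (1) is a lower bound: [chain_free_entries] realizes all nonzero leading coefficients,
    [entries_dominant] deduces that the entries at [T] are independent, and [dominant_generic] turns
    this into existence. [collapse_free] is the combinatorial core of both. *)

Section Chains.

Variable k : nat.

Implicit Types (n : nat) (T : nat -> nat -> bool).

Definition chain n T (I J : nat -> nat) : Prop :=
  [/\ forall s, s < k -> I s < I s.+1, forall s, s < k -> J s < J s.+1,
      I k < J 0, J k < n & forall s, s <= k -> T (I s) (J s)].

Definition chain_free n T : Prop := forall I J, ~ chain n T I J.

Lemma homo_upto (f : nat -> nat) (m : nat) :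
  (forall s, s < m -> f s < f s.+1) ->
  forall s t, s < t <= m -> f s < f t.
Proof.
move=> fS s t /andP[]; elim: t => // t IHt; rewrite ltnS leq_eqVlt.
case/predU1P=> [->|lt_st] lt_tm; first exact: fS.
by apply: ltn_trans (IHt lt_st (ltnW lt_tm)) (fS _ lt_tm).
Qed.

Lemma homo_upto_le (f : nat -> nat) (m : nat) :
  (forall s, s < m -> f s < f s.+1) ->
  forall s t, s <= t <= m -> f s <= f t.
Proof.
move=> fS s t /andP[]; rewrite leq_eqVlt => /predU1P[-> //|lt_st] le_tm.
by apply/ltnW/(homo_upto fS); rewrite lt_st.
Qed.

Lemma homo_upto_ge (f : nat -> nat) (m : nat) :
  (forall s, s < m -> f s < f s.+1) -> forall s, s <= m -> s <= f s.
Proof.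
move=> fS; elim=> // s IHs lt_sm.
by apply: leq_ltn_trans (IHs (ltnW lt_sm)) (fS _ lt_sm).
Qed.

Fact next_subproof n T i c : exists d, (c < d) && ((n <= d) || T i d).
Proof. by exists (maxn n c.+1); rewrite leq_maxr leq_maxl. Qed.

Definition next n T i c := ex_minn (next_subproof n T i c).

(* The points tau 1 < tau 2 < ... are the vertices, other than 0, ..., k, of   *)
(* the k-star of T at the edge {0, k}; all columns from n on count as edges,  *)
(* so that tau is total.                                                      *)
Fixpoint tau n T i := if i is i'.+1 then next n T i' (tau n T i') else k.

Lemma tauP n T i :
  [/\ tau n T i < tau n T i.+1, (n <= tau n T i.+1) || T i (tau n T i.+1)
    & forall c, c < n -> T i c -> (c <= tau n T i) || (tau n T i.+1 <= c)].
Proof.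
rewrite /= /next; case: ex_minnP => d /andP[lt_d Td] min_d; split=> // c lt_cn Tc.
by case: leqP => //= lt_c; apply: min_d; rewrite lt_c Tc orbT.
Qed.

Lemma tau_lt n T i j : i < j -> tau n T i < tau n T j.
Proof.
move=> lt_ij; apply: (@homo_upto (tau n T) j); last by rewrite lt_ij leqnn.
by move=> s _; case: (tauP n T s).
Qed.

Lemma tau_le n T i j : i <= j -> tau n T i <= tau n T j.
Proof. by rewrite leq_eqVlt => /predU1P[->//|lt_ij]; apply/ltnW/tau_lt. Qed.

Lemma tau_gt n T i : k < tau n T i.+1.
Proof. exact: (@tau_lt n T 0). Qed.

(** Otherwise the star edges [(s, tau_(s+1))] with [s < k], followed by [(k, c)], would form a
    chain. *)
Lemma last_row n T c : chain_free n T -> c < n -> T k c -> c <= tau n T k.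
Proof.
move=> freeT lt_cn Tc; rewrite leqNgt; apply/negP => lt_tc.
case: (freeT id (fun s => if s < k then tau n T s.+1 else c)).
split=> [//|s lt_sk|||s le_sk].
- rewrite lt_sk; case: (ltnP s.+1) => [_|le_ks]; first exact: tau_lt.
  by apply: leq_ltn_trans lt_tc; apply: tau_le.
- case: (ltnP 0 k) => [_|le_ks]; first exact: tau_gt.
  by apply: leq_ltn_trans lt_tc; apply: (@tau_le n T 0).
- by rewrite ltnn.
- case: (ltnP s) => [lt_sk|le_ks]; last by rewrite (@anti_leq s k) // le_sk.
  have [_ /orP[le_n|//] _] := tauP n T s.
  by have := leq_ltn_trans (tau_le n T lt_sk) (ltn_trans lt_tc lt_cn); lia.
Qed.

(* The vertices other than 0, ..., k are shifted down by one, and row p < k    *)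
(* merges the rows p and p.+1 of T.                                           *)
Definition collapse n T p c : bool :=
  if (p < k) && (k <= c) then
    (c < tau n T p.+1) && T p.+1 c.+1 || (tau n T p.+1 <= c.+1) && T p c.+1
  else T p.+1 c.+1.

(** Let [m] be the last index where the chain uses the right part of a merged row. After [m], all
    pairs come from rows [I s + 1] of [T]. Up to [m], rows [I s] are used, and a pair from a left
    part is replaced by the star edge at [tau (I s + 1)]; its column moves to the right, but not
    past that of the pair [m]. *)
Lemma collapse_free n T : chain_free n.+1 T -> chain_free n (collapse n.+1 T).
Proof.
move=> freeT I J [Iinc Jinc IJ Jn fT]; set t := tau n.+1 T in fT *.
have Jk s : s <= k -> k <= J s.
  move=> le_sk; have := homo_upto_ge Iinc (leqnn k).
  by have := @homo_upto_le _ _ Jinc 0 s; rewrite le_sk => /(_ isT); lia.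
pose isR s := [&& s <= k, I s < k, t (I s).+1 <= (J s).+1 & T (I s) (J s).+1].
pose J' s := maxn (J s).+1 (t (I s).+1).
have [hasR|noR] := boolP [exists s : 'I_k.+1, isR s]; last first.
  apply: (freeT (fun s => (I s).+1) (fun s => (J s).+1)); split=> //.
  move=> s le_sk; have := fT s le_sk; rewrite /collapse Jk // andbT.
  case: (ltnP (I s) k) => // ltIk /orP[/andP[]//|RI].
  by case/negP: noR; apply/existsP; exists (Ordinal (le_sk : s < k.+1)); apply/and4P;
    case/andP: RI.
have{hasR} exR : exists s, isR s by case/existsP: hasR => s Rs; exists s.
have ubR s : isR s -> s <= k by case/and4P.
case: (ex_maxnP exR ubR) => m Rm max_m; have /and4P[lemk ltImk tm Tm] := Rm.
have J'm : J' m = (J m).+1 by rewrite /J'; apply/maxn_idPl.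
apply: (freeT (fun s => if s <= m then I s else (I s).+1)
              (fun s => if s <= m then J' s else (J s).+1)); split.
- move=> s lt_sk; have := Iinc s lt_sk; case: (leqP s m); case: (leqP s.+1 m); lia.
- move=> s lt_sk; have Js := Jinc s lt_sk; have Is := Iinc s lt_sk.
  case: (ltngtP s m) => [lt_sm|lt_ms|eq_sm]; [|lia|by rewrite eq_sm J'm -eq_sm].
  have := @tau_lt n.+1 T (I s).+1 (I s.+1).+1.
  by rewrite -/t /J' ltnS => /(_ Is); lia.
- by rewrite leq0n /J'; case: (leqP k m) => _; have := leq_maxl (J 0).+1 (t (I 0).+1); lia.
- case: (leqP k m) => [le_km|_]; last by [].
  have eq_km : m = k by apply/eqP; rewrite eqn_leq lemk.
  by move: J'm; rewrite eq_km => ->.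
move=> s le_sk; have := fT s le_sk; rewrite /collapse Jk // andbT.
case: (leqP s m) => [le_sm|lt_ms]; last first.
  case: (ltnP (I s) k) => // ltIk /orP[/andP[]//|/andP[Rt RT]].
  by have := max_m s; rewrite /isR le_sk ltIk Rt RT => /(_ isT); lia.
have leI : I s <= I m by apply: (homo_upto_le Iinc); rewrite le_sm.
rewrite (leq_ltn_trans leI ltImk) => /orP[/andP[Lt LT]|/andP[Rt RT]]; last first.
  by rewrite /J' (maxn_idPl Rt).
rewrite /J' (maxn_idPr _) //.
(* The columns from [n.+1] on are fictitious for [tau], so this star vertex must be shown to lie
   below [n.+1]. *)
have leT : t (I s).+1 <= t (I m).+1 by apply: tau_le.
have lt_tn : t (I s).+1 < n.+1.
  have := @homo_upto_le _ _ Jinc m k; rewrite lemk leqnn => /(_ isT); lia.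
by have [_ + _] := tauP n.+1 T (I s); rewrite leqNgt lt_tn.
Qed.

End Chains.

(** * Size of maximal chain-free sets *)

Section Purity.

Variable k : nat.

Lemma homo_upto_add (f : nat -> nat) (m : nat) :
  (forall s, s < m -> f s < f s.+1) ->
  forall s t, s <= t <= m -> f s + (t - s) <= f t.
Proof.
move=> fS s t; elim: t => [|t IHt]; first by rewrite leqn0 => /andP[/eqP->]; rewrite addn0.
rewrite leq_eqVlt => /andP[/predU1P[->|]]; first by rewrite subnn addn0.
rewrite ltnS => le_st lt_tm; have := fS _ lt_tm.
by have := IHt; rewrite le_st ltnW // => /(_ isT); lia.
Qed.

Definition npairs n (T : nat -> nat -> bool) : nat :=
  \sum_(j < n) \sum_(i < j) T i j.

(* A pair i < j with i and j at cyclic distance at most k is in no             *)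
(* (k+1)-crossing; with these pairs all of tau 1, ..., tau k are below n.      *)
Definition add_short n (T : nat -> nat -> bool) i j : bool :=
  [|| T i j, j - i <= k | n - k <= j - i].

Lemma add_short_free n T : k <= n -> chain_free k n T -> chain_free k n (add_short n T).
Proof.
move=> le_kn freeT I J [Iinc Jinc IJ Jn TS]; apply: (freeT I J); split=> // s le_sk.
have/or3P[//||] := TS s le_sk.
all: have := homo_upto_add Iinc (s := s) (t := k);
  have := homo_upto_add Jinc (s := s) (t := k).
all: have := homo_upto_add Iinc (s := 0) (t := s);
  have := homo_upto_add Jinc (s := 0) (t := s).
all: rewrite le_sk leqnn /= => /(_ isT) h1 /(_ isT) h2 /(_ isT) h3 /(_ isT) h4; lia.
Qed.

Section Inflate.

Variables (n : nat) (T T2 : nat -> nat -> bool).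
Hypothesis le_kn : 2 * k <= n.
Hypothesis shortT : forall i, i < k -> T i (n.+1 - k + i).
Hypothesis freeT2 : chain_free k n T2.
Hypothesis subT2 : forall i j, i < j < n -> collapse k n.+1 T i j -> T2 i j.
Let t := tau k n.+1 T.

(** Row [p < k] of [T2] is cut at [tau_(p+1)]: the left part goes to row [p + 1], the right part to
    row [p], and the column [tau_(p+1)] to both. No pair of a chain ends in a column up to [k], so
    these are filled. *)
Definition inflate i c : bool :=
  if c <= k then true else
  if i <= k then [&& 0 < i, c <= t i & T2 i.-1 c.-1]
                 || [&& i < k, t i.+1 <= c & T2 i c.-1]
  else T2 i.-1 c.-1.

Lemma inflate_sub i j : chain_free k n.+1 T -> i < j < n.+1 -> T i j -> inflate i j.
Proof.
move=> freeT /andP[lt_ij lt_jn] Tij; rewrite /inflate.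
case: (leqP j k) => // lt_kj; case: (leqP i k) => [le_ik|lt_ki]; last first.
  apply: subT2; first by lia.
  by rewrite /collapse (ltnNge i.-1) (_ : k <= i.-1) /= ?prednK //; lia.
have [_ _ cover] := tauP k n.+1 T i.
case: (ltnP i k) => [lt_ik|le_ki] /=; last first.
  have eq_ik : i = k by lia.
  have le_jt : j <= t i by rewrite eq_ik; apply: last_row => //; rewrite -eq_ik.
  have i0 : 0 < i by case: (i) le_jt => //=; rewrite /t /=; lia.
  rewrite orbF i0 le_jt; apply: subT2; first by lia.
  rewrite /collapse (_ : (i.-1 < k) && (k <= j.-1)) ?prednK //; [|lia..].
  by rewrite Tij (le_jt : j <= tau k n.+1 T i).
have /orP[le_j|le_j] := cover _ lt_jn Tij; apply/orP; [left|right].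
  have i0 : 0 < i by case: (i) le_j => //=; lia.
  rewrite i0 le_j /=; apply: subT2; first by lia.
  rewrite /collapse (_ : (i.-1 < k) && (k <= j.-1)) ?prednK //; [|lia..].
  by rewrite Tij le_j.
rewrite le_j; apply: subT2; first by lia.
rewrite /collapse (_ : (i < k) && (k <= j.-1)) ?prednK //; [|lia..].
by rewrite Tij le_j orbT.
Qed.

(** Pairs from a right part pull back to row [I s] of [T2], the others to row [I s - 1]. Two
    consecutive rows could coincide only where a right part is followed by the left part of the same
    row, but then the columns would not increase, as [tau] separates them. *)
Lemma inflate_free : chain_free k n.+1 inflate.
Proof.
move=> I J [Iinc Jinc IJ Jn TS].
pose isR s := [&& I s < k, t (I s).+1 <= J s & T2 (I s) (J s).-1].
have Jk s : s <= k -> k < J s.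
  move=> le_sk; have := homo_upto_add Iinc (s := 0) (t := k).
  have := homo_upto_add Jinc (s := 0) (t := s).
  rewrite leqnn le_sk => /(_ isT) h1 /(_ isT) h2; lia.
have I0 s : s <= k -> ~~ isR s -> 0 < I s.
  move=> le_sk nR; have := TS s le_sk; rewrite /inflate leqNgt Jk //= lt0n.
  by move: nR; rewrite /isR; case: (I s) => //=; move=> /negbTE->.
have Tr s : s <= k -> ~~ isR s -> T2 (I s).-1 (J s).-1 /\ ((I s <= k) ==> (J s <= t (I s))).
  move=> le_sk nR; have := TS s le_sk;
    rewrite /inflate leqNgt Jk //= -/(isR s) (negbTE nR) orbF.
  by case: ifP => //= _ /and3P[].
apply: (freeT2 (I := fun s => if isR s then I s else (I s).-1)
               (J := fun s => (J s).-1)); split.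
- move=> s lt_sk; have := Iinc s lt_sk; have := Jinc s lt_sk.
  have [Rs|nR] := boolP (isR s); have [Rs1|nR1] := boolP (isR s.+1) => //; last 2 first.
  + by move=> _; lia.
  + by have := I0 s.+1 lt_sk nR1; have := I0 s (ltnW lt_sk) nR; lia.
  move=> Js; rewrite leq_eqVlt => /predU1P[eqI|]; last by lia.
  have [_] := Tr s.+1 lt_sk nR1; case/and3P: Rs => lt_Ik tJ _.
  by rewrite -eqI lt_Ik /= => le_Jt; have := leq_trans le_Jt tJ; lia.
- by move=> s lt_sk; have := Jinc s lt_sk; have := Jk s (ltnW lt_sk); lia.
- have := Jk 0 (leq0n _); case: ifP => [/and3P[]|/negbT/(I0 k (leqnn k))]; lia.
- by have := Jk k (leqnn k); lia.
move=> s le_sk; case: ifP => [/and3P[]//|/negbT nR].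
by case: (Tr s le_sk nR).
Qed.

(** The short pair in row [i] caps the search for [tau_(i+1)]; hence [tau_1, ..., tau_k] are genuine
    columns. *)
Lemma tau_bound i : i <= k -> t i <= n - k + i.
Proof.
elim: i => [|i IHi] lt_ik; first by rewrite /t /=; lia.
have [_ _ cover] := tauP k n.+1 T i; have IH := IHi (ltnW lt_ik).
have lt_n : n.+1 - k + i < n.+1 by lia.
have := cover _ lt_n (shortT lt_ik); rewrite -/t; lia.
Qed.

Lemma tau_T2 i : i < k -> T2 i (t i.+1).-1.
Proof.
move=> lt_ik; have b := tau_bound lt_ik; have g := tau_gt k n.+1 T i; rewrite -/t in g.
apply: subT2; first by lia.
rewrite /collapse (_ : (i < k) && (k <= _)) ?prednK //; [|lia..].
have [_ + _] := tauP k n.+1 T i; rewrite -/t leqNgt (_ : t i.+1 < n.+1) ?leqnn /=;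
  last by lia.
by move=> ->; rewrite orbT.
Qed.

(** The gain consists of the [k] duplicated star edges and of at least one pair in each of the
    columns [1, ..., k]. *)
Lemma inflate_count : npairs n T2 + 2 * k <= npairs n.+1 inflate.
Proof.
have col j : j < n ->
    \sum_(i < j) T2 i j + ((j < k) + \sum_(p < k) (t p.+1 == j.+1)) <=
    \sum_(i < j.+1) inflate i j.+1.
  move=> lt_jn; case: (ltnP j k) => [lt_jk|le_kj].
    rewrite [X in _ + (_ + X)]big1 => [|p _]; last first.
      by have := tau_gt k n.+1 T p; rewrite -/t; case: eqP => //; lia.
    rewrite addn0 big_ord_recr /= {2}/inflate lt_jk leq_add2r leq_sum // => i _.
    by rewrite /inflate lt_jk leq_b1.
  (* [m] counts the star vertices up to column [j.+1]. Rows below [m] stay, the others move down by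
     one, and the vacant row [m] receives the duplicate when [j.+1] is a star vertex. *)
  have ex_m : exists m, (k <= m) || (j.+1 < t m.+1) by exists k; rewrite leqnn.
  case: (ex_minnP ex_m) => m m_ok min_m.
  have le_mk : m <= k by apply: min_m; rewrite leqnn.
  have lt_m p : p < m -> t p.+1 <= j.+1.
    move=> lt_pm; rewrite leqNgt; apply/negP => lt_j.
    by have := min_m p; rewrite lt_j orbT => /(_ isT); lia.
  have ge_m p : m <= p -> p < k -> j.+1 < t p.+1.
    move=> le_mp lt_pk; case/orP: m_ok => [|lt_j]; first by lia.
    by apply: leq_trans lt_j _; apply: tau_le.
  have lt_mj : m < j.+1 by lia.
  rewrite (bigD1_ord (Ordinal lt_mj)) //= addnC leq_add //; last first.
    apply: leq_sum => p _; rewrite /inflate ltnNge le_kj /= /bump.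
    case: (leqP m p) => [le_mp|lt_pm]; rewrite ?add1n ?add0n /=.
      case: (ltnP p k) => // lt_pk; rewrite (ltnW (ge_m _ le_mp lt_pk)) /=.
      by case: (T2 p j).
    have lt_pk : p < k by lia.
    by rewrite (ltnW lt_pk) lt_pk lt_m // andTb orbC; case: (T2 p j).
  have [/existsP[p /eqP tp]|/existsPn nop] := boolP [exists p : 'I_k, t p.+1 == j.+1];
    last first.
    by rewrite big1 // => p _; rewrite (negbTE (nop p)).
  rewrite (bigD1 p) //= tp eqxx big1 ?addn0 => [|q]; last first.
    rewrite -val_eqE /= => neq_qp; rewrite -tp.
    have := @tau_lt k n.+1 T q.+1 p.+1; have := @tau_lt k n.+1 T p.+1 q.+1.
    by rewrite -/t !ltnS; case: (ltngtP q p) neq_qp => // _ _; case: eqP => // ->; lia.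
  have def_m : m = p.+1.
    apply/eqP; rewrite eqn_leq; apply/andP; split; last first.
      by rewrite ltnNge; apply/negP => /ge_m/(_ (ltn_ord p)); rewrite tp ltnn.
    apply: min_m; case: (ltnP p.+1 k) => //= lt_pk.
    by rewrite -tp; apply: tau_lt.
  rewrite /inflate ltnNge le_kj /= le_mk def_m /= tp leqnn /=.
  by have := tau_T2 (ltn_ord p); rewrite tp => ->.
rewrite /npairs [X in _ <= X]big_ord_recl big_ord0 add0n.
apply: leq_trans (leq_sum _ (fun (j : 'I_n) _ => col j (ltn_ord j))).
rewrite big_split /= leq_add2l big_split /= mul2n -addnn leq_add //.
  have le_kn2 : k <= n by lia.
  by rewrite -big_mkcond -(big_ord_widen n (fun=> 1) le_kn2) sum1_card card_ord.
rewrite exchange_big /= -[X in X <= _]card_ord -sum1_card leq_sum // => p _.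
have b := tau_bound (ltn_ord p); have g := tau_gt k n.+1 T p; rewrite -/t in g.
have lt_pn : (t p.+1).-1 < n by move: b; have := ltn_ord p; lia.
by rewrite (bigD1 (Ordinal lt_pn)) //= prednK ?eqxx //; lia.
Qed.

End Inflate.

Lemma chain_free_small n T : n <= 2 * k -> chain_free k n T.
Proof.
move=> le_n I J [Iinc Jinc IJ Jn _]; have := homo_upto_add Iinc (s := 0) (t := k).
have := homo_upto_add Jinc (s := 0) (t := k).
by rewrite leqnn => /(_ isT) h1 /(_ isT) h2; lia.
Qed.

(** Induction from [2 * k] vertices, where all pairs are allowed: add the short pairs, collapse,
    extend, and inflate for [2 * k] more pairs. *)
Lemma chain_free_extend n T : 2 * k <= n -> chain_free k n T ->
  exists T', [/\ chain_free k n T', forall i j, i < j < n -> T i j -> T' i j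
    & 'C(2 * k, 2) + 2 * k * (n - 2 * k) <= npairs n T'].
Proof.
move=> /subnKC <-; elim: (n - 2 * k) T => [|m IHm] T freeT.
  exists (fun _ _ => true); split=> //; first by apply: chain_free_small; rewrite addn0.
  rewrite addKn muln0 !addn0 -bin2_sum big_mkord leq_sum // => j _.
  by rewrite sum1_card card_ord.
have le_k : k <= (2 * k + m).+1 by lia.
rewrite addnS in freeT *.
have freeS := add_short_free le_k freeT.
have [T2 [freeT2 subT2 count2]] := IHm _ (collapse_free freeS).
have le_2k : 2 * k <= 2 * k + m by apply: leq_addr.
have shortT i : i < k -> add_short (2 * k + m).+1 T i ((2 * k + m).+1 - k + i).
  by move=> _; rewrite /add_short addnK leqnn !orbT.
exists (inflate (2 * k + m) (add_short (2 * k + m).+1 T) T2); split.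
- exact: inflate_free.
- by move=> i j lt_ij Tij; apply: inflate_sub => //; rewrite /add_short Tij.
apply: leq_trans (inflate_count le_2k shortT subT2).
by move: count2; rewrite !addKn -addnS addKn mulnS addnA; lia.
Qed.

End Purity.

(** * Exponents for the lift of a collapse *)

Definition monge (k : nat) (w : nat -> nat -> nat) : Prop :=
  forall i c, i.+1 < k -> k <= c -> w i.+1 c.+1 + w i c < w i.+1 c + w i c.+1.

Lemma monge_lt k w i c d : monge k w -> i.+1 < k -> k <= c -> c < d ->
  w i.+1 d + w i c < w i.+1 c + w i d.
Proof.
move=> mw lt_ik le_kc; elim: d => // d IHd; rewrite ltnS leq_eqVlt => /predU1P[<-|lt_cd].
  exact: mw.
by have := IHd lt_cd; have := mw i d lt_ik (leq_trans le_kc (ltnW lt_cd)); lia.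
Qed.

Section Exponents.

Variables (k : nat) (t : nat -> nat) (w : nat -> nat -> nat).
Hypothesis t_inc : forall i, t i < t i.+1.
Hypothesis t_gt : forall i, k < t i.+1.
Hypothesis monge_w : monge k w.
Let v i c := w i c.-1.

(** New row [i] combines old rows [i] and [i - 1], with orders doubled. By the Monge condition
    [v i c - v (i - 1) c] decreases in [c]; the exponents put the tie between the two terms at the
    mean of its values at [t i] and [t i.+1], and doubling avoids halves. Row [0] has a single
    term. *)
Definition diag_exp i : nat := if i is j.+1 then v j (t i) + v j (t i.+1) else t 1.

Definition subdiag_exp i : nat := v i (t i) + v i (t i.+1).

(* Between t i and t i.+1, where row i of T is empty, only a lower bound for   *)
(* the order is needed; the last term of the minimum makes the Monge           *)
(* inequality strict there.                                                   *)
Definition inner_exp i c : nat :=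
  if i is j.+1 then
    minn (minn ((v j c).*2 + subdiag_exp i) ((v i c).*2 + diag_exp i))
         (v j c + v i c + v j (t i) + v i (t i.+1))
  else (v 0 c).*2 + minn c (t 1).

Let vlt i c d : i.+1 < k -> k < c -> c < d -> v i.+1 d + v i c < v i.+1 c + v i d.
Proof. by move=> lt_ik lt_kc lt_cd; apply: (monge_lt monge_w lt_ik); lia. Qed.

Lemma inner_exp_left i c : 0 < i < k -> k < c <= t i ->
  inner_exp i c = (v i.-1 c).*2 + subdiag_exp i
  /\ inner_exp i c < (v i c).*2 + diag_exp i.
Proof.
case: i => // i /= lt_ik /andP[lt_kc]; rewrite /inner_exp /subdiag_exp /diag_exp.
have h1 := vlt lt_ik (t_gt i) (t_inc i.+1).
rewrite leq_eqVlt => /predU1P[->|/(vlt lt_ik lt_kc)]; lia.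
Qed.

Lemma inner_exp_right i c : 0 < i < k -> t i.+1 <= c ->
  inner_exp i c = (v i c).*2 + diag_exp i
  /\ inner_exp i c < (v i.-1 c).*2 + subdiag_exp i.
Proof.
case: i => // i /= lt_ik; rewrite /inner_exp /subdiag_exp /diag_exp.
have h1 := vlt lt_ik (t_gt i) (t_inc i.+1).
rewrite leq_eqVlt => /predU1P[<-|/(vlt lt_ik (t_gt _))]; lia.
Qed.

Let inner_exp_dec i c d : i.+1 < k -> k < c -> c < d ->
  inner_exp i.+1 d + (v i c).*2 <= inner_exp i.+1 c + (v i d).*2
  /\ (t i.+1 <= c -> inner_exp i.+1 d + (v i c).*2 < inner_exp i.+1 c + (v i d).*2).
Proof.
move=> lt_ik lt_kc lt_cd; rewrite /inner_exp /subdiag_exp /diag_exp.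
have h1 := vlt lt_ik lt_kc lt_cd; split; first by lia.
move=> le_tc; have := vlt lt_ik (t_gt i) (leq_ltn_trans le_tc lt_cd); lia.
Qed.

Let inner_exp_inc i c d : i < k -> k < c -> c < d ->
  inner_exp i c + (v i d).*2 <= inner_exp i d + (v i c).*2
  /\ (c < t i.+1 -> inner_exp i c + (v i d).*2 < inner_exp i d + (v i c).*2).
Proof.
case: i => [|i] lt_ik lt_kc lt_cd; first by rewrite /inner_exp; lia.
rewrite /inner_exp /subdiag_exp /diag_exp.
have h1 := vlt lt_ik lt_kc lt_cd; split; first by lia.
move=> lt_ct; have := vlt lt_ik lt_kc lt_ct; lia.
Qed.

(** Both rows are compared with the old row they share: relative to [(v i c).*2], row [i.+1] weakly
    decreases, strictly from [t i.+1] on, while row [i] weakly increases, strictly before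
    [t i.+1]. *)
Lemma inner_exp_monge i c : i.+1 < k -> k < c ->
  inner_exp i.+1 c.+1 + inner_exp i c < inner_exp i.+1 c + inner_exp i c.+1.
Proof.
move=> lt_ik lt_kc.
have [] := inner_exp_dec lt_ik lt_kc (ltnSn c).
have [] := inner_exp_inc (ltnW lt_ik) lt_kc (ltnSn c).
by case: (ltnP c (t i.+1)) => [_ h1 /(_ isT) h2|_ h1 _ h2 /(_ isT)]; lia.
Qed.

End Exponents.

Local Open Scope ring_scope.

(** * Realizations over K[t] *)

Section Lead.

Variable K : fieldType.
Implicit Types (f g : {poly K}) (a b : K) (d e : nat).

(** [b] may be zero, so this also expresses a mere bound on the order. *)
Definition lead f e b : Prop := exists r, f = 'X^e * (b%:P + 'X * r).

Lemma lead0 e : lead 0 e 0.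
Proof. by exists 0; rewrite polyC0 !mulr0 addr0 mulr0. Qed.

Lemma leadXn e b : lead (b *: 'X^e) e b.
Proof. by exists 0; rewrite mulr0 addr0 -mul_polyC mulrC. Qed.

Lemma leadD f g e a b : lead f e a -> lead g e b -> lead (f + g) e (a + b).
Proof. by move=> [r ->] [s ->]; exists (r + s); rewrite polyCD; ring. Qed.

Lemma leadZ c f e b : lead f e b -> lead (c *: f) e (c * b).
Proof. by move=> [r ->]; exists (c *: r); rewrite -!mul_polyC polyCM; ring. Qed.

Lemma leadN f e b : lead f e b -> lead (- f) e (- b).
Proof. by move=> /(leadZ (-1)); rewrite scaleN1r mulN1r. Qed.

Lemma leadM f g d e a b : lead f d a -> lead g e b -> lead (f * g) (d + e) (a * b).
Proof.
move=> [r ->] [s ->]; exists (a%:P * s + b%:P * r + 'X * r * s).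
by rewrite polyCM exprD; ring.
Qed.

Lemma lead_dvd f g e d : (e < d)%N -> g = 'X^d * f -> lead g e 0.
Proof.
move=> lt_ed ->; exists ('X^((d - e).-1) * f).
by rewrite polyC0 add0r !mulrA -exprSr -exprD; congr ('X^_ * _); lia.
Qed.

Lemma lead_lt f d e b : (e < d)%N -> lead f d b -> lead f e 0.
Proof. by move=> lt_ed [r /(lead_dvd lt_ed)]. Qed.

Lemma lead_le f d e b : (e <= d)%N -> lead f d b -> exists a, lead f e a.
Proof.
rewrite leq_eqVlt => /predU1P[-> lf|lt_ed lf]; first by exists b.
by exists 0; apply: lead_lt lf.
Qed.

Lemma lead_mulXn f d e b : lead f e b -> lead ('X^d * f) (d + e) b.
Proof.
by move=> fl; rewrite -['X^d]scale1r -[b]mul1r; apply: leadM fl; apply: leadXn.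
Qed.

Lemma lead_comp f e b : lead f e b -> lead (f \Po 'X^2) (e * 2) b.
Proof.
move=> [r ->]; exists ('X * (r \Po 'X^2)).
by rewrite comp_polyM comp_polyD comp_polyM comp_polyX comp_polyC rmorphXn /= comp_polyX
  mulnC exprM; ring.
Qed.

Lemma lead_sum (I : Type) (s : seq I) (P : pred I) (F : I -> {poly K}) e (B : I -> K) :
  (forall i, P i -> lead (F i) e (B i)) ->
  lead (\sum_(i <- s | P i) F i) e (\sum_(i <- s | P i) B i).
Proof. by move=> ldF; apply: (big_ind2 (fun f b => lead f e b)) => // [|????];
  [exact: lead0|exact: leadD]. Qed.

Lemma lead_prod (I : Type) (s : seq I) (F : I -> {poly K}) (E : I -> nat) (B : I -> K) :
  (forall i, lead (F i) (E i) (B i)) ->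
  lead (\prod_(i <- s) F i) (\sum_(i <- s) E i) (\prod_(i <- s) B i).
Proof.
move=> ldF; elim: s => [|i s IHs]; rewrite ?big_nil ?big_cons; last exact: leadM.
by have := leadXn 0 (1 : K); rewrite expr0 scale1r.
Qed.

Lemma lead_exp f e b m : lead f e b -> lead (f ^+ m) (e * m) (b ^+ m).
Proof.
move=> fl; elim: m => [|m IHm]; last by rewrite !exprS mulnS; apply: leadM.
by have := leadXn 0 (1 : K); rewrite muln0 !expr0 scale1r.
Qed.

Lemma lead_neq0 f e b : lead f e b -> b != 0 -> f != 0.
Proof.
move=> [r ->] b0; rewrite mulf_neq0 ?expf_neq0 ?polyX_eq0 //.
apply: contraNneq b0 => /(congr1 (horner^~ 0)).
by rewrite !hornerE => ->.
Qed.

End Lead.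

Section Realization.

Variables (K : fieldType) (k0 : nat).
Let k := k0.+1.
Local Notation R := {poly K}.
Implicit Types (n : nat) (T : nat -> nat -> bool) (w : nat -> nat -> nat).

Definition wedge (x y x' y' : 'rV[R]_k) : R := (x *m y'^T - y *m x'^T) 0 0.

Lemma wedgeE (x y x' y' : 'rV[R]_k) :
  wedge x y x' y' = (x *m y'^T) 0 0 - (x' *m y^T) 0 0.
Proof.
rewrite /wedge !mxE; congr (_ - _); apply: eq_bigr => i _.
by rewrite !mxE mulrC.
Qed.

(* Vertex c >= k is the vector (p c, q c) of the symplectic space K[t]^(2k),   *)
(* and vertex i < k is the i-th vector (delta_i, 0) of a Lagrangian basis, so   *)
(* that the entry at (i, c) is q c 0 i.                                       *)
Definition realized n T w (b : nat -> nat -> K) (p q : nat -> 'rV[R]_k) : Prop :=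
  (forall (i : 'I_k) c, (k <= c < n)%N ->
     exists a, lead (q c 0 i) (w i c) a /\ (T i c -> a = b i c)) /\
  (forall c d, (k <= c)%N -> (c < d < n)%N -> T c d ->
     lead (wedge (p c) (q c) (p d) (q d)) (w c d) (b c d)).

(** The exponents are fixed before the leading coefficients; this uniformity is what yields
    algebraic independence. *)
Definition realizable n T : Prop :=
  exists2 w, monge k w &
    forall b, (forall i j, b i j != 0) -> exists p q, realized n T w b p q.

Lemma realizable_base T : realizable k T.
Proof.
exists (fun i c => (k - i) * c)%N.
  by move=> i c lt_ik _; rewrite -(subnSK (ltnW lt_ik)); lia.
by move=> b _; exists (fun=> 0), (fun=> 0); split=> [i c|c d]; lia.
Qed.

Section Step.

Variables (n : nat) (T : nat -> nat -> bool) (w : nat -> nat -> nat).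
Hypothesis le_kn : (k <= n)%N.
Hypothesis freeT : chain_free k n.+1 T.
Hypothesis monge_w : monge k w.
Let t := tau k n.+1 T.

Let t_inc i : (t i < t i.+1)%N. Proof. by case: (tauP k n.+1 T i). Qed.
Let t_gt i : (k < t i.+1)%N. Proof. exact: tau_gt. Qed.

Let S := (\sum_(i < k) diag_exp t w i)%N.
Let F := (\sum_(i < k) inner_exp t w i k.+1)%N.+1.
Let E := (\sum_(c < n.+1) (S + (w k.-1 c.-1).*2))%N.+1.

(* The new vertex k is attached with the huge exponents E + i * F, so that it  *)
(* does not affect the leading coefficients of the other entries.             *)
Definition step_exp i c : nat :=
  (if i < k then if c <= k then E + i * F else inner_exp t w i c
   else S + (w i.-1 c.-1).*2)%N.

Lemma step_exp_monge : monge k step_exp.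
Proof.
move=> i c lt_ik le_kc; rewrite /step_exp lt_ik (ltnW lt_ik) (_ : (c < k)%N = false);
  last by lia.
case: (ltngtP k c) le_kc => // [lt_kc|<-] _; first exact: inner_exp_monge.
suff: (inner_exp t w i.+1 k.+1 < F)%N by rewrite mulSn; lia.
by rewrite ltnS (bigD1 (Ordinal lt_ik)) //= leq_addr.
Qed.

Variable b : nat -> nat -> K.
Hypothesis b_neq0 : forall i j, b i j != 0.

(** In column [t i.+1] the new rows [i] and [i.+1] get their leading terms from the same old entry;
    this factor adjusts their ratio. *)
Definition diag_coef i : K :=
  if T i.+1 (t i.+1) then b i (t i.+1) / b i.+1 (t i.+1) else 1.

Definition collapse_coef i c : K :=
  if ((i < k) && (k <= c))%N then
    if (c < t i.+1)%N && T i.+1 c.+1 then b i.+1 c.+1 else b i c.+1 / diag_coef i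
  else b i.+1 c.+1.

Lemma diag_coef_neq0 i : diag_coef i != 0.
Proof. by rewrite /diag_coef; case: ifP; rewrite ?oner_neq0 // mulf_neq0 ?invr_neq0. Qed.

Lemma collapse_coef_neq0 i c : collapse_coef i c != 0.
Proof.
by rewrite /collapse_coef; do 2?case: ifP => // _;
  rewrite mulf_neq0 ?invr_neq0 // diag_coef_neq0.
Qed.

Definition step_mx : 'M[R]_k := \matrix_(i, j)
  if i == j then diag_coef i *: 'X^(diag_exp t w i)
  else if i == j.+1 :> nat then 'X^(subdiag_exp t w i) else 0.

Let c0 : K := \prod_(i < k) diag_coef i.

Let c0_neq0 : c0 != 0.
Proof. by apply/prodf_neq0 => i _; apply: diag_coef_neq0. Qed.

Lemma det_step_mx : \det step_mx = c0 *: 'X^S.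
Proof.
rewrite det_trig; last first.
  apply/is_trig_mxP => i j lt_ij; rewrite mxE -val_eqE /=.
  by case: ltngtP lt_ij => // lt_ij _; case: eqP => // eq_ij; lia.
under eq_bigr do rewrite mxE eqxx -mul_polyC.
rewrite big_split /= prodrXr -mul_polyC; congr (_ * _).
by rewrite -(rmorph_prod (@polyC K)).
Qed.

Lemma mul_step_mx (x : 'rV[R]_k) i :
  (x *m step_mx^T) 0 i = diag_coef i *: ('X^(diag_exp t w i) * x 0 i) +
    (if (0 < i)%N then 'X^(subdiag_exp t w i) * x 0 (inord i.-1) else 0).
Proof.
rewrite mxE (bigD1 i) //= !mxE eqxx scalerAl mulrC; congr (_ + _).
case: ltnP => [i_gt0|le_i0]; last first.
  rewrite big1 // => j neq_ji; rewrite !mxE eq_sym (negbTE neq_ji).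
  by case: eqP => [?|_]; [exfalso; lia|rewrite mulr0].
have lt_i : (i.-1 < k)%N by have := ltn_ord i; lia.
rewrite (bigD1 (inord i.-1)) /=; last by rewrite -val_eqE /= inordK //; lia.
rewrite !mxE -val_eqE /= inordK // prednK // eqxx mulrC.
case: eqP => [?|_]; first by exfalso; lia.
rewrite big1 ?addr0 // => j /andP[neq_ji]; rewrite -val_eqE /= inordK // => neq_j.
rewrite !mxE eq_sym (negbTE neq_ji).
case: eqP => [eqi|_]; last by rewrite mulr0.
by case/eqP: neq_j; rewrite eqi.
Qed.

Variables p q : nat -> 'rV[R]_k.
Hypothesis pq : realized n (collapse k n.+1 T) w collapse_coef p q.

Let sq (x : 'rV[R]_k) := map_mx (comp_poly 'X^2) x.

Definition step_q c : 'rV[R]_k :=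
  if (c <= k)%N then \row_i (b i k *: 'X^(E + i * F)%N) else sq (q c.-1) *m step_mx^T.

(** With the adjugate on [p] against [step_mx] on [q], wedges are multiplied by ['X^S] and no power
    of the variable is divided out. Vertex [k] is the image of the last old Lagrangian vector,
    perturbed by its high-order [q] part. *)
Definition step_p c : 'rV[R]_k :=
  c0^-1%:P *: (if (c <= k)%N then row ord_max (\adj step_mx)
               else sq (p c.-1) *m \adj step_mx).

Lemma wedge_sq c d :
  wedge (sq (p c)) (sq (q c)) (sq (p d)) (sq (q d)) = wedge (p c) (q c) (p d) (q d) \Po
    'X^2.
Proof.
by rewrite /wedge !map_trmx -!map_mxM -(map_mxB (comp_poly 'X^2)) mxE.
Qed.

Lemma adj_step (x y : 'rV[R]_k) :
  (c0^-1%:P *: (x *m \adj step_mx)) *m (y *m step_mx^T)^T = 'X^S *: (x *m y^T).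
Proof.
rewrite trmx_mul trmxK -scalemxAl -mulmxA [\adj _ *m _]mulmxA mul_adj_mx det_step_mx.
rewrite mul_scalar_mx -scalemxAr scalerA mul_polyC scalerA mulVf // scale1r.
by [].
Qed.

Lemma wedge_step (x y x' y' : 'rV[R]_k) :
  wedge (c0^-1%:P *: (x *m \adj step_mx)) (y *m step_mx^T)
        (c0^-1%:P *: (x' *m \adj step_mx)) (y' *m step_mx^T) = 'X^S * wedge x y x' y'.
Proof.
by rewrite !wedgeE !adj_step !(mxE _ (fun _ _ => _ * _)) mulrBr.
Qed.

Lemma collapse_left i c : (0 < i)%N -> (i <= k)%N -> (k < c <= t i)%N -> T i c ->
  collapse k n.+1 T i.-1 c.-1 /\ collapse_coef i.-1 c.-1 = b i c.
Proof.
move=> i_gt0 le_ik /andP[lt_kc le_ct] Tic; rewrite /collapse /collapse_coef.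
rewrite (_ : (i.-1 < k)%N && (k <= c.-1)%N) ?prednK //; [|by lia..].
by rewrite Tic (le_ct : (c <= tau k n.+1 T i)%N) ?le_ct.
Qed.

Lemma collapse_right i c : (i < k)%N -> (t i.+1 <= c)%N -> T i c ->
  collapse k n.+1 T i c.-1 /\ diag_coef i * collapse_coef i c.-1 = b i c.
Proof.
move=> lt_ik le_tc Tic; have lt_kc := leq_trans (t_gt i) le_tc.
rewrite /collapse /collapse_coef (_ : (i < k)%N && (k <= c.-1)%N) ?prednK //; [|by lia..].
rewrite Tic (le_tc : (tau k n.+1 T i.+1 <= c)%N) orbT; split=> //.
case: ifP => [/andP[lt_ct T1]|_]; last by rewrite mulrC divfK ?diag_coef_neq0.
(* The left and right parts share only the star column. *)
have eq_c : t i.+1 = c by lia.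
by rewrite /diag_coef eq_c T1 divfK.
Qed.

Lemma step_realized : realized n.+1 T step_exp b step_p step_q.
Proof.
have [ldq ldw] := pq.
have ldsq (i : 'I_k) c : (k < c < n.+1)%N -> exists a,
    lead (sq (q c.-1) 0 i) (w i c.-1).*2 a /\
    (collapse k n.+1 T i c.-1 -> a = collapse_coef i c.-1).
  move=> lt_c; have [|a [lda Ta]] := ldq i c.-1; first by lia.
  by exists a; rewrite mxE -muln2; split=> //; apply: lead_comp.
split=> [i c /andP[le_kc lt_cn]|c d le_kc /andP[lt_cd lt_dn] Tcd].
  rewrite /step_exp ltn_ord /step_q; case: leqP => [le_ck|lt_kc].
    by exists (b i k); rewrite mxE (_ : c = k); [split; first exact: leadXn | lia].
  have lt_c : (k < c < n.+1)%N by rewrite lt_kc.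
  have [ai [ldi Ti]] := ldsq i c lt_c.
  have {}ldi := leadZ (diag_coef i) (lead_mulXn (diag_exp t w i) ldi).
  have [_ _ cover] := tauP k n.+1 T i.
  rewrite mul_step_mx; case: ltnP => [i_gt0|le_i0]; last first.
    have i0 : (i : nat) = 0%N by lia.
    rewrite addr0 /inner_exp i0 /=; rewrite i0 /= in ldi.
    case: (leqP (t 1) c) => [le_tc|lt_ct]; last first.
      (* Row [0] of [T] is empty strictly between [k] and [t 1], so a bound on the order suffices
         here. *)
      have [|a lda] := lead_le (e := ((w 0 c.-1).*2 + c)%N) _ ldi; first by lia.
      exists a; split=> // T0; exfalso.
      have := cover _ lt_cn; rewrite i0 => /(_ T0); rewrite -/t (leqNgt (t 1)) lt_ct orbF.
      by rewrite (leqNgt c) lt_kc.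
    exists (diag_coef 0 * ai); split=> [|T0]; first by rewrite addnC.
    have [] := collapse_right (ltn0Sn k0) le_tc T0.
    by move: Ti; rewrite i0 => Ti /Ti ->.
  have lt_i : (i.-1 < k)%N by have := ltn_ord i; lia.
  have [aj [ldj Tj]] := ldsq (inord i.-1) c lt_c; rewrite inordK // in ldj Tj.
  have {}ldj := lead_mulXn (subdiag_exp t w i) ldj.
  have [Tic|nTic] := boolP (T i c); last first.
    have [|a lda] := lead_le (e := inner_exp t w i c) _ ldi.
      by rewrite /inner_exp; case: (i : nat) i_gt0 => //= *; lia.
    have [|a' lda'] := lead_le (e := inner_exp t w i c) _ ldj.
      by rewrite /inner_exp; case: (i : nat) i_gt0 => //= *; lia.
    by exists (a + a'); split=> //; apply: leadD.
  have lt_0ik : (0 < i < k)%N by rewrite i_gt0 ltn_ord.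
  exists (b i c); split=> //; have /orP[le_ct|le_tc] := cover _ lt_cn Tic.
    have lt_ct : (k < c <= t i)%N by rewrite lt_kc.
    have [eq_e lt_e] := inner_exp_left t_inc t_gt monge_w lt_0ik lt_ct.
    have [fT <-] := collapse_left i_gt0 (ltnW (ltn_ord i)) lt_ct Tic.
    rewrite -(Tj fT) -[aj]add0r; apply: leadD; last by rewrite eq_e addnC.
    by apply: lead_lt ldi; rewrite addnC.
  have [eq_e lt_e] := inner_exp_right t_inc t_gt monge_w lt_0ik le_tc.
  have [fT <-] := collapse_right (ltn_ord i) le_tc Tic.
  rewrite -(Ti fT) -[_ * ai]addr0; apply: leadD; first by rewrite eq_e addnC.
  by apply: lead_lt ldj; rewrite addnC.
have lt_kd : (k < d)%N by lia.
rewrite /step_exp ltnNge le_kc /= /step_p /step_q (leqNgt d) lt_kd /=.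
case: leqP => [le_ck|lt_kc]; last first.
  rewrite wedge_step wedge_sq; apply: lead_mulXn; rewrite -muln2; apply: lead_comp.
  have [le_k1 eq_c] : (k <= c.-1)%N /\ c.-1.+1 = c by lia.
  have : collapse k n.+1 T c.-1 d.-1 /\ collapse_coef c.-1 d.-1 = b c d.
    by rewrite /collapse /collapse_coef (ltnNge c.-1) le_k1 /= !prednK //; lia.
  by case=> fT <-; apply: ldw => //; lia.
have eq_c : c = k by lia.
rewrite eq_c in Tcd *; rewrite {le_kc le_ck lt_cd eq_c}.
have lt_d : (k < d < n.+1)%N by rewrite lt_kd.
have [a [lda Ta]] := ldsq ord_max d lt_d.
(* Row [k] lies entirely in the left part of the merged row [k.-1]. *)
have le_dt : (k < d <= t k)%N by rewrite lt_kd; apply: last_row.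
have [fT coefE] := collapse_left (ltn0Sn k0) (leqnn k) le_dt Tcd.
rewrite -coefE -(Ta fT) -[a]addr0 /wedge rowE adj_step -rowE mxE; apply: leadD.
  by rewrite mxE in lda; rewrite !mxE; apply: lead_mulXn.
rewrite mxE -[X in lead _ _ X]oppr0; apply: leadN.
have lt_E : (S + (w k.-1 d.-1).*2 < E)%N.
  by rewrite ltnS (bigD1 (Ordinal lt_dn)) //= leq_addr.
(* The contribution of the [q] part of vertex [k] is divisible by ['X^E], and [E] exceeds the
   required order. *)
pose G := \sum_(i < k) b i k *: 'X^(i * F)%N * (c0^-1%:P *: (sq (p d.-1) *m \adj
  step_mx)) 0 i.
apply: (lead_dvd (f := G) lt_E); rewrite [LHS]mxE mulr_sumr; apply: eq_bigr => i _.
by rewrite !mxE exprD -!mul_polyC; ring.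
Qed.

End Step.

Lemma chain_free_realizable n T : (k <= n)%N -> chain_free k n T -> realizable n T.
Proof.
move/subnKC <-; elim: (n - k)%N T => [|m IHm] T; first by rewrite addn0 => _;
  apply: realizable_base.
rewrite addnS => freeT; have [w monge_w wP] := IHm _ (collapse_free freeT).
exists (step_exp (k + m) T w); first (apply: step_exp_monge; last by [];
  first by apply: leq_addr).
move=> b b_neq0; have [p [q pq]] := wP _ (collapse_coef_neq0 (k + m) T b_neq0).
exists (step_p (k + m) T w b p), (step_q (k + m) T w b q).
by apply: step_realized => //; apply: leq_addr.
Qed.

(** A realization says nothing about pairs among the first [k] vertices, which are isotropic. They
    get terms in ['X^E], with [E] above all [w i j], so that the other leading terms survive. *)
Lemma chain_free_entries n T : (k <= n)%N -> chain_free k n T ->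
  exists e : nat -> nat -> nat, forall b : nat -> nat -> K, (forall i j, b i j != 0) ->
    exists X Y : 'M[R]_(n, k), forall i j : 'I_n, (i < j)%N -> T i j ->
      lead ((X *m Y^T - Y *m X^T) i j) (e i j) (b i j).
Proof.
move=> le_kn freeT; have [w _ wP] := chain_free_realizable le_kn freeT.
pose E := (\sum_(i < n) \sum_(j < n) w i j)%N.+1.
exists (fun i j => if (j < k)%N then E else w i j) => b b_neq0.
have [p [q [ldq ldw]]] := wP b b_neq0.
pose x i : 'rV[R]_k := if (i < k)%N then delta_mx 0 (inord i) else p i.
pose y i : 'rV[R]_k := if (i < k)%N then \row_j (if (j < i)%N then b j i *: 'X^E else 0)
  else q i.
exists (\matrix_(i < n) x i), (\matrix_(i < n) y i) => i j lt_ij Tij.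
have -> : ((\matrix_(i < n) x i) *m (\matrix_(i < n) y i)^T -
   (\matrix_(i < n) y i) *m (\matrix_(i < n) x i)^T) i j = wedge (x i) (y i) (x j) (y j).
  by rewrite /wedge !mxE; congr (_ - _); apply: eq_bigr => l _; rewrite !mxE.
have delta_mul l (z : 'rV[R]_k) : (l < k)%N -> (delta_mx 0 (inord l) *m z^T) 0 0 = z 0
  (inord l).
  move=> _; rewrite mxE (bigD1 (inord l)) //= big1 => [|m /negbTE neq_m].
    by rewrite !mxE !eqxx mul1r addr0.
  by rewrite mxE neq_m andbF mul0r.
case: (ltnP j k) => [lt_jk|le_kj].
  have lt_ik := ltn_trans lt_ij lt_jk.
  rewrite wedgeE /x /y lt_ik lt_jk !delta_mul // !mxE !inordK // lt_ij (ltnNge j) (ltnW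
    lt_ij) /= subr0.
  exact: leadXn.
case: (ltnP i k) => [lt_ik|le_ki]; last first.
  by rewrite /x /y (ltnNge i) (ltnNge j k) le_ki le_kj /=; apply: ldw;
    rewrite ?lt_ij ?ltn_ord.
have [|a [lda Ta]] := ldq (inord i) j; first by rewrite le_kj ltn_ord.
rewrite inordK // in lda Ta; rewrite -(Ta Tij) -[a]subr0.
rewrite wedgeE /x /y lt_ik (ltnNge j) le_kj /= delta_mul //.
apply: leadD => //; apply: leadN.
have lt_E : (w i j < E)%N.
  by rewrite ltnS (bigD1 i) //= (bigD1 j) //= -addnA leq_addr.
pose G := \sum_(l < k) p j 0 l * (if (l < i)%N then b l i else 0)%:P.
apply: (lead_dvd (f := G) lt_E); rewrite [LHS]mxE mulr_sumr; apply: eq_bigr => l _.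
by rewrite !mxE; case: ifP => _; rewrite ?polyC0 -?mul_polyC; ring.
Qed.

End Realization.

(** * Zariski density *)

Definition infinite (K : eqType) : Prop := forall s : seq K, exists x, x \notin s.

Section NonVanishing.

Variable K : fieldType.
Hypothesis infK : infinite K.

Lemma infinite_uniq m : exists2 s : seq K, uniq s & size s = m.
Proof.
elim: m => [|m [s us <-]]; first by exists [::].
by have [x xs] := infK s; exists (x :: s) => //=; rewrite xs.
Qed.

Lemma poly_nonroot (p : {poly K}) : p != 0 -> exists x, ~~ root p x.
Proof.
move=> p0; have [s us size_s] := infinite_uniq (size p).
have [/hasP[x _ px]|/hasPn nr] := boolP (has (fun x => ~~ root p x) s); first by exists x.
have : all (root p) s by apply/allP => x /nr; rewrite negbK.
by move=> /(max_poly_roots p0)/(_ us); rewrite size_s ltnn.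
Qed.

Lemma base_inj d n (f g : nat -> nat) :
  (forall i, (i < n)%N -> (f i < d)%N) -> (forall i, (i < n)%N -> (g i < d)%N) ->
  (\sum_(i < n) f i * d ^ i = \sum_(i < n) g i * d ^ i)%N ->
  forall i, (i < n)%N -> f i = g i.
Proof.
elim: n f g => [|n IHn] f g ltf ltg; first by move=> _ [].
have d_gt0 : (0 < d)%N by apply: leq_ltn_trans (ltf 0 isT).
have shift (h : nat -> nat) : (\sum_(i < n.+1) h i * d ^ i = h 0 + (\sum_(i < n) h i.+1 *
  d ^ i) * d)%N.
  rewrite big_ord_recl expn0 muln1; congr addn; rewrite big_distrl /=.
  by apply: eq_bigr => i _; rewrite /bump add1n expnSr mulnA.
rewrite !shift => eq_s.
have eq0 : f 0 = g 0.
  by have := congr1 (modn^~ d) eq_s;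
    rewrite !(addnC _ (_ * d)%N) !modnMDl !modn_small // ?ltf ?ltg.
have eqS : (\sum_(i < n) f i.+1 * d ^ i = \sum_(i < n) g i.+1 * d ^ i)%N.
  by apply/eqP; rewrite -(eqn_pmul2r d_gt0); apply/eqP; move: eq_s; rewrite eq0 => /addnI.
case=> // i lt_i; apply: (IHn (fun i => f i.+1) (fun i => g i.+1)) => // j lt_j;
  [exact: ltf|exact: ltg].
Qed.

(* Kronecker substitution: X_i goes to x ^ (d ^ i). *)
Lemma mpoly_nonvanishing n (p : {mpoly K[n]}) : p != 0 -> exists v, p.@[v] != 0.
Proof.
move=> p0; pose d := msize p; pose wt (m : 'X_{1..n}) := (\sum_(i < n) m i * d ^ i)%N.
pose P : {poly K} := \sum_(m <- msupp p) p@_m *: 'X^(wt m).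
have wt_inj : {in msupp p &, injective wt}.
  move=> m1 m2 m1p m2p eq_wt; apply/mnmP => i.
  have lt_m m : m \in msupp p -> forall j, (j < n)%N -> ((if insub j is Some j' then m j'
    else 0) < d)%N.
    move=> mp j lt_j; rewrite insubT /=; apply: leq_ltn_trans (msize_mdeg_lt mp).
    by rewrite mdegE (bigD1 (Sub j lt_j)) //= leq_addr.
  have := @base_inj d n _ _ (lt_m _ m1p) (lt_m _ m2p) _ i (ltn_ord i).
  by rewrite valK; apply; move: eq_wt; rewrite /wt; congr (_ = _);
     apply: eq_bigr => j _; rewrite valK.
have [m mp] : exists m, m \in msupp p.
  by case: (msupp p) (msupp_eq0 p) p0 => [|m s] <- // _; exists m; rewrite mem_head.
have P0 : P != 0.
  apply/eqP => /(congr1 (fun q : {poly K} => q`_(wt m))); rewrite coef0 coef_sum.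
  rewrite (bigD1_seq m) ?msupp_uniq //= coefZ coefXn eqxx mulr1 big_seq_cond big1 ?addr0.
    by apply/eqP; rewrite -mcoeff_msupp.
  move=> m' /andP[m'p neq_m]; rewrite coefZ coefXn; case: eqP => [/wt_inj eq_m|_];
    last by rewrite mulr0.
  by rewrite eq_m // eqxx in neq_m.
have [x] := poly_nonroot P0; rewrite /root => Px; exists (fun i => x ^+ (d ^ i)).
apply: contraNneq Px => <-; rewrite mevalE horner_sum; apply/eqP/eq_bigr => m' _.
rewrite hornerZ hornerXn; congr (_ * _); rewrite /wt -prodrXr.
by apply: eq_bigr => i _; rewrite -exprM mulnC.
Qed.

(** [Q0] is the initial form of [Q] for the weights [E], and [w] its weight; neither depends on [M]
    or [u]. *)
Lemma lead_mpoly s (Q : {mpoly K[s]}) (E : 'I_s -> nat) : Q != 0 ->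
  exists w (Q0 : {mpoly K[s]}), Q0 != 0 /\
    forall (M : 'I_s -> {poly K}) u, (forall a, lead (M a) (E a) (u a)) ->
      lead (mmap (@polyC K) M Q) w Q0.@[u].
Proof.
move=> Q_neq0; pose wt (m : 'X_{1..s}) := (\sum_(a < s) E a * m a)%N.
have ex_w : exists w, has (fun m => wt m == w) (msupp Q).
  case: (msupp Q) (msupp_eq0 Q) Q_neq0 => [|m l] <- // _.
  by exists (wt m); rewrite /= eqxx.
case: (ex_minnP ex_w) => w /hasP[m0 m0Q /eqP wt0] min_w.
exists w, (\sum_(m <- msupp Q | wt m == w) Q@_m *: 'X_[m]); split.
  apply/eqP => /(congr1 (mcoeff m0)); rewrite mcoeff0 raddf_sum /=.
  rewrite big_mkcond (bigD1_seq m0) ?msupp_uniq //= wt0 eqxx mcoeffZ mcoeffX eqxx mulr1.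
  rewrite big1 ?addr0; first by apply/eqP; rewrite -mcoeff_msupp.
  by move=> m neq_m; rewrite mcoeffZ mcoeffX (negbTE neq_m) mulr0 if_same.
move=> M u ldM; rewrite /mmap raddf_sum /= [X in lead _ _ X]big_mkcond /= big_seq [X in
  lead _ _ X]big_seq.
apply: lead_sum => m mQ; rewrite mul_polyC.
have ldm : lead (mmap1 M m) (wt m) (\prod_a u a ^+ m a).
  by apply: lead_prod => a; apply: lead_exp.
case: eqP => [wt_m|/eqP wt_m]; first by rewrite mevalZ mevalX -wt_m; apply: leadZ.
rewrite -(mulr0 Q@_m); apply: leadZ; apply: lead_lt ldm.
by rewrite ltn_neqAle eq_sym wt_m min_w //; apply/hasP; exists m.
Qed.

Lemma horner_mmap s (Q : {mpoly K[s]}) (M : 'I_s -> {poly K}) x :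
  (mmap (@polyC K) M Q).[x] = Q.@[fun a => (M a).[x]].
Proof.
rewrite mevalE /mmap horner_sum; apply: eq_bigr => m _.
rewrite mul_polyC hornerZ; congr (_ * _); rewrite horner_prod.
by apply: eq_bigr => a _; rewrite horner_exp.
Qed.

End NonVanishing.

(** * Quantifier elimination and dominant maps *)

Section Chevalley.

Variable K : fieldType.
Hypothesis closedK : GRing.closed_field_axiom K.

Lemma closed_infinite : infinite K.
Proof.
move=> s; pose p : {poly K} := \prod_(a <- s) ('X - a%:P).
have [s0|s_gt0] := posnP (size s); first by exists 0; rewrite (size0nil s0).
have size_p : size (p + 1) = (size s).+1.
  by rewrite size_polyDl size_prod_XsubC ?size_poly1.
have /(PreClosedField.closed_rootP closedK)[x] : size (p + 1) != 1%N by rewrite size_p; lia.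
rewrite rootE hornerD hornerC horner_prod => px; exists x; apply: contraTN px => xs.
by rewrite (big_rem _ xs) /= hornerXsubC subrr mul0r add0r oner_eq0.
Qed.

Variable s : nat.

Lemma term_mpoly (t : GRing.term K) : GRing.rterm t ->
  exists p : {mpoly K[s]}, forall v, p.@[v] = GRing.eval (codom v) t.
Proof.
elim: t => [i|x|m|t1 IH1 t2 IH2|t IHt|t IHt m|t1 IH1 t2 IH2|t IHt|t IHt m] //=.
- have [lt_is|le_si] := ltnP i s; last first.
    by exists 0 => v; rewrite meval0 nth_default // size_codom card_ord.
  exists 'X_(Ordinal lt_is) => v; rewrite mevalXU.
  rewrite (nth_map (Ordinal lt_is)) ?size_enum_ord //.
  by rewrite (nth_ord_enum (Ordinal lt_is) (Ordinal lt_is)).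
- by exists x%:MP => v; rewrite mevalC.
- by exists m%:R => v; rewrite rmorph_nat.
- by move=> /andP[/IH1[p1 e1] /IH2[p2 e2]]; exists (p1 + p2) => v; rewrite mevalD e1 e2.
- by move=> /IHt[p ep]; exists (- p) => v; rewrite mevalN ep.
- by move=> /IHt[p ep]; exists (p *+ m) => v; rewrite mevalMn ep.
- by move=> /andP[/IH1[p1 e1] /IH2[p2 e2]]; exists (p1 * p2) => v; rewrite mevalM e1 e2.
- by move=> /IHt[p ep]; exists (p ^+ m) => v; rewrite rmorphXn /= ep.
Qed.

(** An atomic equation is either an identity or false wherever the difference of its sides is
    nonzero; the exceptional polynomials are multiplied. *)
Lemma qf_generic f : GRing.qf_form f -> GRing.rformula f ->
  exists2 p : {mpoly K[s]}, p != 0 &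
    exists d, forall v, p.@[v] != 0 -> GRing.qf_eval (codom v) f = d.
Proof.
elim: f => //= [d _ _|t1 t2 _ /andP[rt1 rt2]|f1 IH1 f2 IH2|f1 IH1 f2 IH2|f1 IH1 f2 IH2|f1
  IH1].
- by exists 1; [exact: oner_neq0|exists d].
- have [p1 e1] := term_mpoly rt1; have [p2 e2] := term_mpoly rt2.
  have [/eqP eq_p|neq_p] := boolP (p1 == p2).
    by exists 1; [exact: oner_neq0|exists true => v _; rewrite -e1 -e2 eq_p eqxx].
  exists (p1 - p2); rewrite ?subr_eq0 //; exists false => v.
  by rewrite mevalB subr_eq0 e1 e2 => /negbTE.
all: try (move=> /andP[q1 q2] /andP[r1 r2]; have [p1 p1n [d1 e1]] := IH1 q1 r1;
  have [p2 p2n [d2 e2]] := IH2 q2 r2;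
  exists (p1 * p2); [by rewrite mulf_neq0|]).
- by exists (d1 && d2) => v; rewrite mevalM mulf_eq0 negb_or => /andP[/e1-> /e2->].
- by exists (d1 || d2) => v; rewrite mevalM mulf_eq0 negb_or => /andP[/e1-> /e2->].
- by exists (d1 ==> d2) => v; rewrite mevalM mulf_eq0 negb_or => /andP[/e1-> /e2->].
by move=> q1 r1; have [p1 p1n [d1 e1]] := IH1 q1 r1; exists p1 => //;
  exists (~~ d1) => v /e1->.
Qed.

(** Eliminating quantifiers from the description of the image gives a condition of constant truth
    value off a hypersurface. Were that value false, the hypersurface would contain the image,
    against dominance. *)
Lemma dominant_generic N (h : 'I_s -> GRing.term K) :
  (forall a, GRing.rterm (h a)) ->
  (forall a (e e' : seq K), (forall i, (s <= i < s + N)%N -> e`_i = e'`_i) ->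
     GRing.eval e (h a) = GRing.eval e' (h a)) ->
  (forall Q : {mpoly K[s]}, Q != 0 -> exists e, Q.@[fun a => GRing.eval e (h a)] != 0) ->
  exists2 g : {mpoly K[s]}, g != 0 &
    forall v, g.@[v] != 0 -> exists e, forall a, GRing.eval e (h a) = v a.
Proof.
move=> rh localh domh.
pose eqs := \big[GRing.And/GRing.Bool true]_(a < s) GRing.Equal (GRing.Var K a) (h a).
pose f := foldr (@GRing.Exists K) eqs (iota s N).
have r_eqs : GRing.rformula eqs.
  by rewrite /eqs; apply: (big_ind (@GRing.rformula K)) => //= f1 f2 -> ->.
have rf : GRing.rformula f by rewrite /f; elim: (iota s N).
have eqsP e : GRing.holds e eqs <-> forall a : 'I_s, e`_a = GRing.eval e (h a).
  rewrite /eqs; split=> [|eq_h].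
    move=> hold_e a; have := mem_index_enum a; elim: (index_enum _) hold_e => // a' l IHl.
    rewrite big_cons /= => -[eq_a' /IHl{}IHl]; rewrite inE => /predU1P[->|/IHl] //.
  by apply: (big_ind (GRing.holds e)) => //= *; split.
have vE v (a : 'I_s) : (codom v)`_a = v a :> K.
  by rewrite (nth_map a) ?size_enum_ord // nth_ord_enum.
have fP v : GRing.holds (codom v) f <-> exists e, forall a, GRing.eval e (h a) = v a.
  rewrite -GRing.foldExistsP; split=> [[e eq_e /eqsP eq_h]|[e eq_h]].
    exists e => a; rewrite -eq_h -eq_e ?vE // !inE mem_iota; have := ltn_ord a; lia.
  exists (codom v ++ [seq e`_i | i <- iota s N]).
    move=> i; rewrite !inE mem_iota nth_cat size_codom card_ord.
    case: (ltnP i s) => //= le_si lt_i; rewrite [LHS]nth_default ?nth_default //.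
      by rewrite size_map size_iota; lia.
    by rewrite size_codom card_ord.
  apply/eqsP => a; rewrite nth_cat size_codom card_ord ltn_ord vE -eq_h.
  apply: localh => i lt_i;
    rewrite nth_cat size_codom card_ord (ltnNge i) (_ : (s <= i)%N) /=; last by lia.
  by rewrite (nth_map 0%N) ?size_iota ?nth_iota ?subnKC //; lia.
have wf := ClosedFieldQE.wf_ex_elim (F := K);
  have ok := ClosedFieldQE.holds_ex_elim closedK.
have /andP[qg rg] := GRing.quantifier_elim_wf wf rf.
have gP e := GRing.quantifier_elim_rformP wf ok e rf.
have [p p_neq0 [[] eq_d]] := qf_generic qg rg.
  by exists p => // v /eq_d/gP/fP.
have [e pe] := domh p p_neq0.
by case/negP: (negbT (eq_d _ pe)); apply/gP/fP; exists e.
Qed.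

End Chevalley.

(** * Algebraic dependence of the entries *)

Section Dependence.

Variable K : fieldType.

Lemma msizeM_deg s (p q : {mpoly K[s]}) c d :
  (msize p <= c.+1)%N -> (msize q <= d.+1)%N -> (msize (p * q) <= (c + d).+1)%N.
Proof.
have [->|p0] := eqVneq p 0; first by rewrite mul0r msize0.
have [->|q0] := eqVneq q 0; first by rewrite mulr0 msize0.
by rewrite msizeM //; move: (msize p) (msize q) => a b; lia.
Qed.

Lemma msizeX_deg s (p : {mpoly K[s]}) c m :
  (msize p <= c.+1)%N -> (msize (p ^+ m) <= (m * c).+1)%N.
Proof.
move=> sp; elim: m => [|m IHm]; first by rewrite expr0 msize1.
by rewrite exprS mulSn; apply: msizeM_deg.
Qed.

Lemma msize_prod_deg s (I : finType) (F : I -> {mpoly K[s]}) c :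
  (forall i, msize (F i) <= c.+1)%N -> (msize (\prod_i F i) <= (#|I| * c).+1)%N.
Proof.
move=> sF; have -> : \prod_i F i = \prod_(i <- enum I) F i by rewrite big_enum.
rewrite cardE; elim: (enum I) => [|i l IHl]; first by rewrite big_nil msize1.
by rewrite big_cons /= mulSn; apply: msizeM_deg.
Qed.

Lemma linear_dependence (I J : finType) (L : I -> J -> K) : (#|J| < #|I|)%N ->
  exists2 r : I -> K, (exists i, r i != 0) & forall j, \sum_i r i * L i j = 0.
Proof.
move=> ltJI; pose A : 'M_(#|I|, #|J|) := \matrix_(i, j) L (enum_val i) (enum_val j).
have : kermx A != 0.
  by rewrite kermx_eq0 /row_free neq_ltn (leq_ltn_trans (rank_leq_col _) ltJI).
case/rowV0Pn => x /sub_kermxP xA x0.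
exists (fun i => x 0 (enum_rank i)).
  case/rV0Pn: x0 => i xi; exists (enum_val i); by rewrite enum_valK.
move=> j; have := congr1 (fun B : 'rV_#|J| => B 0 (enum_rank j)) xA; rewrite !mxE => xAj.
rewrite -[RHS]xAj.
rewrite (reindex (@enum_val I I)) /=; last by apply: onW_bij; apply: enum_val_bij.
by apply: eq_bigr => i _; rewrite mxE enum_rankK enum_valK.
Qed.

(* Multiplied by delta ^ (N d), the monomials of degree at most d in each of  *)
(* the N fractions span a space of dimension O(d ^ s).                        *)
Lemma dependent_fractions s N (h : 'I_N -> {mpoly K[s]}) (delta : {mpoly K[s]}) :
  (s < N)%N -> exists2 Q : {mpoly K[N]}, Q != 0 &
    forall u, delta.@[u] != 0 -> Q.@[fun a => (h a).@[u] / delta.@[u]] = 0.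
Proof.
move=> lt_sN; pose C := maxn (msize delta) (\max_a msize (h a)).
have sd : (msize delta <= C.+1)%N by rewrite ltnW // ltnS leq_maxl.
have sh a : (msize (h a) <= C.+1)%N.
  by rewrite ltnW // ltnS leq_max orbC; rewrite (leq_bigmax a).
(* Since [B <= (N * C).+1 * d.+1], this makes [B ^ s] at most [d * d.+1 ^ s], which is less than the
   number [d.+1 ^ N] of monomials. *)
pose d := ((N * C).+1 ^ s)%N.
pose G (m : {ffun 'I_N -> 'I_d.+1}) := \prod_a (h a ^+ m a * delta ^+ (d - m a)).
pose B := (N * (d * C)).+1.
have sG m : (msize (G m) <= B)%N.
  have -> : B = (#|'I_N| * (d * C)).+1 by rewrite card_ord.
  apply: msize_prod_deg => a.
  have -> : (d * C = m a * C + (d - m a) * C)%N by rewrite -mulnDl subnKC // -ltnS.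
  by apply: msizeM_deg; apply: msizeX_deg.
pose L (m : {ffun 'I_N -> 'I_d.+1}) (c : {ffun 'I_s -> 'I_B}) := (G m)@_[multinom (c i :
  nat) | i < s].
have [|r [m0 r0] rL] := @linear_dependence _ _ L.
  rewrite !card_ffun !card_ord.
  apply: (@leq_ltn_trans ((N * C).+1 ^ s * d.+1 ^ s)%N).
    have le_B : (B <= (N * C).+1 * d.+1)%N by rewrite /B; nia.
    by rewrite -expnMn; case: (posnP s) => [->|s_gt0]; rewrite ?expn0 ?leq_exp2r.
  rewrite -/d (leq_trans (n := d.+1 * d.+1 ^ s)%N) ?ltn_pmul2r ?expn_gt0 //.
  by rewrite -expnS leq_pexp2l.
pose mon (m : {ffun 'I_N -> 'I_d.+1}) := [multinom (m a : nat) | a < N].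
have mon_inj : injective mon.
  move=> m1 m2 /mnmP eq_m; apply/ffunP => a; apply/val_inj.
  by have := eq_m a; rewrite !mnmE.
exists (\sum_m r m *: 'X_[mon m]).
  apply/eqP => /(congr1 (mcoeff (mon m0))); rewrite mcoeff0 raddf_sum /= (bigD1 m0) //=.
  rewrite mcoeffZ mcoeffX eqxx mulr1 big1 ?addr0; first by apply/eqP.
  by move=> m neq_m; rewrite mcoeffZ mcoeffX (inj_eq mon_inj) (negbTE neq_m) mulr0.
move=> u du; have sum0 : \sum_m r m *: G m = 0.
  apply/mpolyP => c; rewrite mcoeff0 raddf_sum /=.
  have [lt_cB|le_Bc] := ltnP (mdeg c) B; last first.
    by rewrite big1 // => m _;
      rewrite mcoeffZ memN_msupp_eq0 ?mulr0 // msize_mdeg_ge // (leq_trans (sG m)).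
  have lt_c i : (c i < B)%N by apply: leq_ltn_trans lt_cB;
    rewrite mdegE (bigD1 i) //= leq_addr.
  rewrite -[RHS](rL [ffun i => Ordinal (lt_c i)]); apply: eq_bigr => m _;
    rewrite mcoeffZ /L.
  by congr (_ * (G m)@__); apply/mnmP => i; rewrite mnmE ffunE.
have := congr1 (meval u) sum0; rewrite meval0 raddf_sum /= => sum_u.
apply: (mulfI (x := delta.@[u] ^+ (d * N))); first by rewrite expf_neq0.
rewrite mulr0 -[RHS]sum_u raddf_sum /= mulr_sumr; apply: eq_bigr => m _.
rewrite !mevalZ mulrCA; congr (_ * _); rewrite mevalX rmorph_prod /=.
rewrite exprM -[X in _ ^+ X]card_ord -prodr_const -big_split /=; apply: eq_bigr => a _.
rewrite mevalM !rmorphXn /= mnmE expr_div_n mulrCA; congr (_ * _).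
have : (m a <= d)%N by rewrite -ltnS.
move: (nat_of_ord (m a)) => e le_ed.
by rewrite -{1}(subnKC le_ed) exprD mulrC mulKf // expf_neq0.
Qed.

End Dependence.

Section Edges.

Variable n : nat.
Implicit Types (e : edge n) (I : {set 'I_n}).

Definition edge_set e : {set 'I_n} := [set src e; tgt e].

Lemma edge_lt e : (src e < tgt e)%N. Proof. exact: (valP e). Qed.

Lemma edge_set_inj : injective edge_set.
Proof.
move=> e f eq_ef; apply/val_inj.
have : (src f \in edge_set e) && (tgt f \in edge_set e) by rewrite eq_ef !inE !eqxx orbT.
rewrite !inE => /andP[/orP[]/eqP s_f /orP[]/eqP t_f].
all: have lt_e := edge_lt e; have lt_f := edge_lt f; rewrite s_f t_f in lt_f;
  try by exfalso; lia.
by rewrite [val e]surjective_pairing [val f]surjective_pairing; congr (_, _).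
Qed.

Lemma card_edge_set e : #|edge_set e| = 2.
Proof. by rewrite cards2; have := edge_lt e; case: eqP => // ->; rewrite ltnn. Qed.

Lemma card_incident_edges I :
  (#|[set e | (src e \in I) || (tgt e \in I)]| + 'C(n - #|I|, 2) <= 'C(n, 2))%N.
Proof.
pose A := edge_set @: [set e | (src e \in I) || (tgt e \in I)].
pose B := [set S : {set 'I_n} | S \subset ~: I & #|S| == 2].
have cardB : #|B| = 'C(n - #|I|, 2) by rewrite cards_draws cardsCs setCK card_ord.
rewrite -(card_imset _ edge_set_inj) -cardB -[X in 'C(X, 2)]card_ord -card_draws.
have disjAB : [disjoint A & B].
  rewrite disjoint_subset; apply/subsetP => _ /imsetP[e + ->];
    rewrite !inE card_edge_set eqxx andbT.
  move=> eI; apply/negP => /subsetP sub; move: eI.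
  by have := sub (src e); have := sub (tgt e);
    rewrite !inE !eqxx orbT => /(_ isT)/negbTE-> /(_ isT)/negbTE->.
have /eqP <- : #|A :|: B| == (#|A| + #|B|)%N by rewrite (leq_card_setU A B).2.
apply/subset_leq_card/subsetP => S; rewrite !inE => /orP[/imsetP[e _ ->]|/andP[]//].
by rewrite card_edge_set.
Qed.

End Edges.

Section Charts.

Variables (K : fieldType) (n : nat).

(** [I] indexes a row basis. By skew symmetry the same columns have full rank, so the block on [I]
    is invertible, and the rows and columns in [I] determine [M]. *)
Lemma principal_minor (M : 'M[K]_n) : M^T = - M ->
  exists2 I : {set 'I_n}, #|I| = \rank M &
    let X := mxsub (@enum_val _ (mem I)) (@enum_val _ (mem I)) M in
    X \in unitmx /\
    M = colsub (@enum_val _ (mem I)) M *m invmx X *m rowsub (@enum_val _ (mem I)) M.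
Proof.
move=> skewM; pose I := [set maxrankfun M i | i in 'I_(\rank M)].
have cardI : #|I| = \rank M by rewrite card_imset ?card_ord //; apply: maxrankfun_inj.
exists I => //; set f := @enum_val _ (mem I); set X := mxsub f f M.
have eqR : (rowsub f M :=: M)%MS.
  apply/eqmxP/andP; split; first by apply/row_subP => i; rewrite row_rowsub row_sub.
  rewrite -(eq_maxrowsub M); apply/row_subP => i; rewrite row_rowsub.
  have iI : maxrankfun M i \in I by apply: imset_f.
  by rewrite -(enum_rankK_in iI iI) -row_rowsub row_sub.
have /submxP[Z defM] : (M <= rowsub f M)%MS by rewrite eqR.
have defC : colsub f M = Z *m X by rewrite {1}defM -mulmx_colsub [X]mxsubcr.
have rankC : \rank (colsub f M) = #|I|.
  rewrite -[colsub f M]trmxK mxrank_tr trmx_mxsub skewM.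
  have -> : rowsub f (- M) = - rowsub f M by apply/matrixP => i j; rewrite !mxE.
  by rewrite mxrank_opp eqR -cardI.
have uX : X \in unitmx.
  rewrite -row_free_unit /row_free eqn_leq rank_leq_row -{1}rankC defC.
  exact: mxrankM_maxr.
split=> //; rewrite {1}defM; congr (_ *m _).
by rewrite defC mulmxK.
Qed.

Lemma skew_entry (M : 'M[K]_n) i j : skew_symmetric M -> M j i = - M i j.
Proof. by case=> /matrixP/(_ i j); rewrite !mxE. Qed.

(** On this chart all entries are fractions with denominator [\det X] in the entries at edges
    meeting [I], and there are fewer than [N] such edges. *)
Lemma chart_dependence (I : {set 'I_n}) N (g : 'I_N -> edge n) :
  ('C(n, 2) - 'C(n - #|I|, 2) < N)%N ->
  let f := @enum_val _ (mem I) in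
  exists2 Q : {mpoly K[N]}, Q != 0 &
    forall M : 'M[K]_n, skew_symmetric M -> mxsub f f M \in unitmx ->
      M = colsub f M *m invmx (mxsub f f M) *m rowsub f M ->
      Q.@[fun a => M (src (g a)) (tgt (g a))] = 0.
Proof.
move=> ltN f; pose E := [set e : edge n | (src e \in I) || (tgt e \in I)].
pose s := #|E|; have lt_sN : (s < N)%N.
  apply: leq_ltn_trans ltN; rewrite leq_subRL; last by apply: leq_bin2l; apply: leq_subr.
  by rewrite addnC; apply: card_incident_edges.
pose at_ (a : 'I_s) : edge n := enum_val a.
pose gen i j : {mpoly K[s]} :=
  if [pick a | val (at_ a) == (i, j)] is Some a then 'X_a
  else if [pick a | val (at_ a) == (j, i)] is Some a then - 'X_a else 0.
have gen_eval (M : 'M[K]_n) i j : skew_symmetric M -> (i \in I) || (j \in I) ->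
    (gen i j).@[fun a => M (src (at_ a)) (tgt (at_ a))] = M i j.
  move=> skewM ijI; have in_E (x y : 'I_n) : (x < y)%N -> (x \in I) || (y \in I) ->
      exists a, val (at_ a) = (x, y).
    move=> lt_xy xyI; pose e : edge n := Sub (x, y) lt_xy.
    have eE : e \in E by rewrite inE.
    by exists (enum_rank_in eE e); rewrite /at_ enum_rankK_in.
  rewrite /gen; case: pickP => [a /eqP ea|no1].
    by rewrite mevalXU /src /tgt ea.
  case: pickP => [a /eqP ea|no2].
    by rewrite mevalN mevalXU /src /tgt ea (skew_entry i j skewM) opprK.
  rewrite meval0; case: (ltngtP i j) => [lt_ij|lt_ji|/val_inj->]; last by rewrite skewM.2.
    by have [a ea] := in_E i j lt_ij ijI; have := no1 a; rewrite ea eqxx.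
  rewrite orbC in ijI.
  by have [a ea] := in_E j i lt_ji ijI; have := no2 a; rewrite ea eqxx.
pose X := \matrix_(x, y) gen (f x) (f y).
pose C := \matrix_(i, y) gen i (f y).
pose R := \matrix_(x, j) gen (f x) j.
pose h a := (C *m \adj X *m R) (src (g a)) (tgt (g a)).
have [Q Q0 QP] := dependent_fractions h (\det X) lt_sN.
exists Q => // M skewM uX defM; pose u a := M (src (at_ a)) (tgt (at_ a)).
have fI x : f x \in I by apply: enum_valP.
have evX : map_mx (meval u) X = mxsub f f M.
  by apply/matrixP => x y; rewrite !mxE gen_eval ?fI.
have evC : map_mx (meval u) C = colsub f M.
  by apply/matrixP => x y; rewrite !mxE gen_eval ?fI ?orbT.
have evR : map_mx (meval u) R = rowsub f M.
  by apply/matrixP => x y; rewrite !mxE gen_eval ?fI.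
have ev_det : (\det X).@[u] = \det (mxsub f f M) by rewrite -evX det_map_mx.
have det0 : \det (mxsub f f M) != 0 by rewrite -unitfE -unitmxE.
rewrite -[RHS](QP u) ?ev_det //; apply: meval_eq => a.
have -> : (h a).@[u] = (map_mx (meval u) (C *m \adj X *m R)) (src (g a)) (tgt (g a)) by
  rewrite mxE.
rewrite !map_mxM map_mx_adj evX evC evR {1}defM /invmx uX.
by rewrite -scalemxAr -scalemxAl mxE mulrC.
Qed.

(** By [principal_minor] the charts with [#|I| <= r] cover these matrices; the relations of the
    charts are multiplied. *)
Lemma low_rank_dependence r N (g : 'I_N -> edge n) : ('C(n, 2) - 'C(n - r, 2) < N)%N ->
  exists2 Q : {mpoly K[N]}, Q != 0 &
    forall M : 'M[K]_n, skew_symmetric M -> (\rank M <= r)%N ->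
      Q.@[fun a => M (src (g a)) (tgt (g a))] = 0.
Proof.
move=> ltN; pose f (I : {set 'I_n}) := @enum_val _ (mem I).
have exQ (I : {set 'I_n}) : exists Q : {mpoly K[N]}, Q != 0 /\
    ((#|I| <= r)%N -> forall M : 'M[K]_n, skew_symmetric M -> mxsub (f I) (f I) M \in
      unitmx ->
      M = colsub (f I) M *m invmx (mxsub (f I) (f I) M) *m rowsub (f I) M ->
      Q.@[fun a => M (src (g a)) (tgt (g a))] = 0).
  have [le_Ir|lt_rI] := leqP #|I| r; last by exists 1; rewrite oner_neq0; split.
  have [|Q Q0 QP] := @chart_dependence I N g; last by exists Q.
  by apply: leq_ltn_trans ltN; apply/leq_sub2l/leq_bin2l/leq_sub2l.
have [F FP] := fin_all_exists exQ.
exists (\prod_I F I); first by apply/prodf_neq0 => I _; case: (FP I).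
move=> M skewM rM; have [I cardI [uX defM]] := principal_minor skewM.1.
rewrite rmorph_prod /= (bigD1 I) //=.
by rewrite (proj2 (FP I)) ?mul0r // cardI.
Qed.

End Charts.

(** * Edges and chains *)

Section Transfer.

Variables (n k : nat).
Implicit Types (T : nat -> nat -> bool) (D : {set edge n}).

Definition edge_rel D i j : bool :=
  [exists e in D, (src e == i :> nat) && (tgt e == j :> nat)].

Definition rel_edges T : {set edge n} := [set e | T (src e) (tgt e)].

Lemma edge_rel_in D e : edge_rel D (src e) (tgt e) = (e \in D).
Proof.
apply/exists_inP/idP => [[e' e'D /andP[/eqP s_e /eqP t_e]]|eD]; last by exists e;
  rewrite ?eqxx.
suff <- : e' = e by [].
apply/val_inj; rewrite [val e']surjective_pairing [val e]surjective_pairing.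
by congr (_, _); apply/val_inj.
Qed.

Lemma crossing_free_chain_free D : crossing_free k.+1 D -> chain_free k n (edge_rel D).
Proof.
move=> /forallP freeD I J [Iinc Jinc IJ Jn TD].
have exE (s : 'I_k.+1) : exists e : edge n, [&& e \in D, src e == I s :> nat & tgt e == J
  s :> nat].
  have /exists_inP[e eD eIJ] := TD s (ltn_ord s : s <= k)%N.
  by exists e; rewrite eD.
have [E EP] := fin_all_exists exE.
have Es s : src (E s) = I s :> nat by case/and3P: (EP s) => _ /eqP.
have Et s : tgt (E s) = J s :> nat by case/and3P: (EP s) => _ _ /eqP.
have crossE (s t : 'I_k.+1) : (s < t)%N -> cross (E s) (E t).
  move=> lt_st; apply/orP; left; rewrite !Es !Et.
  have [le_sk le_tk] := (leq_ord s, leq_ord t).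
  have I_st : (I s < I t)%N by apply: homo_upto Iinc _ _ _; rewrite lt_st.
  have J_st : (J s < J t)%N by apply: homo_upto Jinc _ _ _; rewrite lt_st.
  have I_tk : (I t <= I k)%N by apply: homo_upto_le Iinc _ _ _; rewrite le_tk leqnn.
  have J_0s : (J 0 <= J s)%N by apply: homo_upto_le Jinc _ _ _; rewrite le_sk.
  by apply/and3P; split; lia.
have E_inj : injective E.
  move=> s t eqE; apply/val_inj; case: (ltngtP s t) => // /crossE; rewrite eqE /cross;
  by case/orP => /and3P[]; rewrite ltnn.
have /implyP := freeD (E @: [set: 'I_k.+1]); case/(_ _)/negP.
  by apply/subsetP => _ /imsetP[s _ ->]; case/and3P: (EP s).
rewrite /is_crossing card_imset // cardsT card_ord eqxx.
apply/forall_inP => _ /imsetP[s _ ->]; apply/forall_inP => _ /imsetP[t _ ->].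
rewrite (inj_eq E_inj); apply/implyP; rewrite neq_ltn => /orP[/crossE//|/crossE].
by rewrite /cross orbC.
Qed.

(** Sorted by sources, mutually crossing edges form a chain. *)
Lemma chain_free_crossing_free T : (0 < k)%N ->
  chain_free k n T -> crossing_free k.+1 (rel_edges T).
Proof.
move=> k_gt0 freeT; apply/forallP => S; apply/implyP => /subsetP subST.
apply/negP => /andP[/eqP cardS /forall_inP crossS].
pose leS (e f : edge n) := (src e <= src f)%N; pose l := sort leS (enum S).
have leS_total : total leS by move=> e f; apply: leq_total.
have leS_tr : transitive leS by move=> e f g; apply: leq_trans.
have size_l : size l = k.+1 by rewrite size_sort -cardE.
have mem_l e : (e \in l) = (e \in S) by rewrite mem_sort mem_enum.
have uniq_l : uniq l by rewrite sort_uniq enum_uniq.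
have [e0 _] : exists e0, e0 \in l by case: (l) size_l => // e0 l' _; exists e0;
  rewrite mem_head.
pose E := nth e0 l.
have ES s : (s <= k)%N -> E s \in S by move=> le_sk; rewrite -mem_l mem_nth // size_l.
have crossE s t : (s < t <= k)%N -> [&& src (E s) < src (E t), src (E t) < tgt (E s) &
  tgt (E s) < tgt (E t)]%N.
  move=> /andP[lt_st le_tk]; have le_sk : (s <= k)%N by apply: ltnW (leq_trans lt_st le_tk).
  have neq : E s != E t by rewrite nth_uniq ?size_l ?ltnS // neq_ltn lt_st.
  have /forall_inP/(_ _ (ES _ le_tk))/implyP/(_ neq) := crossS _ (ES _ le_sk).
  have : leS (E s) (E t).
    have sorted_l : sorted leS l by apply: sort_sorted.
    by apply: (sorted_ltn_nth leS_tr e0 sorted_l); rewrite ?inE ?size_l.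
  by rewrite /leS /cross => le_st /orP[//|/and3P[]]; rewrite ltnNge le_st.
apply: (freeT (fun s => src (E s)) (fun s => tgt (E s))); split.
- by move=> s lt_sk; have /and3P[] : _ := crossE s s.+1 (introT andP (conj (ltnSn s)
  lt_sk)).
- by move=> s lt_sk; have /and3P[] : _ := crossE s s.+1 (introT andP (conj (ltnSn s)
  lt_sk)).
- by have /and3P[] : _ := crossE 0 k (introT andP (conj k_gt0 (leqnn k))).
- exact: ltn_ord.
- by move=> s le_sk; have := subST _ (ES s le_sk); rewrite inE.
Qed.

Lemma npairs_le_card T : (npairs n T <= #|rel_edges T|)%N.
Proof.
have widen (j : 'I_n) : (\sum_(i < j) T i j = \sum_(i < n) ((i < j) && T i j))%N.
  rewrite (big_ord_widen n (fun i => T i j : nat) (ltnW (ltn_ord j))) big_mkcond /=.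
  by apply: eq_bigr => i _; case: ifP.
rewrite /npairs (eq_bigr _ (fun j _ => widen j)) exchange_big pair_big /=.
rewrite -(card_imset _ val_inj) -sum1_card [X in (_ <= X)%N]big_mkcond /=.
apply: leq_sum => -[i j] _ /=; case: (boolP (_ && _)) => // /andP[lt_ij Tij].
suff -> : (i, j) \in val @: rel_edges T by [].
by apply/imsetP; exists (Sub (i, j) lt_ij) => //; rewrite inE.
Qed.

Lemma bin2D a m : ('C(a + m, 2) = 'C(a, 2) + a * m + 'C(m, 2))%N.
Proof.
elim: m => [|m IHm]; first by rewrite muln0 bin0n !addn0.
by rewrite addnS !binS !bin1 IHm mulnS; lia.
Qed.

Lemma k_triangulation_card D : (0 < k)%N -> (2 * k <= n)%N -> k_triangulation k D ->
  ('C(n, 2) - 'C(n - 2 * k, 2) <= #|D|)%N.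
Proof.
move=> k_gt0 le_kn /maxsetP[freeD maxD].
have [T [freeT subT countT]] := chain_free_extend le_kn (crossing_free_chain_free freeD).
have defD : rel_edges T = D.
  apply: maxD; first exact: chain_free_crossing_free.
  apply/subsetP => e eD; rewrite inE subT ?edge_rel_in //.
  by rewrite (edge_lt e) ltn_ord.
rewrite -defD; apply: leq_trans (npairs_le_card T); apply: leq_trans countT.
by rewrite -{1}(subnKC le_kn) bin2D addnK.
Qed.

End Transfer.

(** * Finiteness of generic completions *)

Lemma finite_entries (K : fieldType) n (P : 'M[K]_n -> Prop) (s : seq K) :
  (forall M, P M -> forall i j, M i j \in s) -> finitely_many P.
Proof.
move=> Ps; pose mx (F : {ffun 'I_n * 'I_n -> seq_sub s}) : 'M[K]_n := \matrix_(i, j) val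
  (F (i, j)).
exists (codom mx) => M /Ps Ms.
apply/codomP; exists [ffun p => SeqSub (Ms p.1 p.2)].
by apply/matrixP => i j; rewrite mxE ffunE.
Qed.

Lemma poly_roots_finite (K : fieldType) (p : {poly K}) :
  p != 0 -> exists s : seq K, forall x, root p x -> x \in s.
Proof.
elim: {p}(size p) {-2}p (leqnn (size p)) => [|m IHm] p size_p p0.
  by rewrite -size_poly_gt0 ltnNge size_p in p0.
case: (classic (exists x, root p x)) => [[x /factor_theorem[q defp]]|no_root]; last first.
  by exists [::] => x px; case: no_root; exists x.
have q0 : q != 0 by apply: contraNneq p0 => q0; rewrite defp q0 mul0r.
have [|s sP] := IHm q _ q0.
  by move: size_p; rewrite defp size_Mmonic ?monicXsubC // size_XsubC addn2.
exists (x :: s) => y; rewrite defp rootM root_XsubC inE => /orP[/sP->|->//].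
by rewrite orbT.
Qed.

Lemma zariski_open_nonvanishing (K : fieldType) (I : finType) (p : {mpoly K[#|I|]}) :
  zariski_open (fun v : {ffun I -> K} => p.@[fun i => v (enum_val i)] != 0).
Proof. by exists (eq p) => v; split=> [pv|[_ <-]//]; exists p. Qed.

Lemma generically_nonvanishing (K : fieldType) (I : finType) (p : {mpoly K[#|I|]})
    (P : {ffun I -> K} -> Prop) : infinite K -> p != 0 ->
  (forall v : {ffun I -> K}, p.@[fun i => v (enum_val i)] != 0 -> P v) -> generically P.
Proof.
move=> infK p0 pP; exists (fun v : {ffun I -> K} => p.@[fun i => v (enum_val i)] != 0);
  split=> //.
  exact: zariski_open_nonvanishing.
have [v pv] := mpoly_nonvanishing infK p0; exists [ffun x => v (enum_rank x)].
by rewrite (meval_eq (v2 := v)) // => i; rewrite ffunE enum_valK.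
Qed.

Section Finite.

Variables (K : fieldType) (n k : nat) (T D : {set edge n}).
Hypothesis infK : infinite K.
Hypothesis subDT : D \subset T.
Let N0 := ('C(n, 2) - 'C(n - 2 * k, 2))%N.
Hypothesis cardD : (N0 <= #|D|)%N.
Local Notation I := {e : edge n | e \in T}.

(** [Q] relates [N0] entries in [D] to the entry at [e]. [P] is [Q] with the last variable fixed at
    a coordinate of a point [w] where [Q] is nonzero; where [P] does not vanish, [Q] stays nonzero
    as a polynomial in the entry at [e]. *)
Lemma entry_generically_finite e : exists P : {mpoly K[#|{: I}|]}, P != 0 /\
  forall v : {ffun I -> K}, P.@[fun i => v (enum_val i)] != 0 ->
    exists s : seq K, forall M, low_rank_completion k v M -> M (src e) (tgt e) \in s.
Proof.
pose g (a : 'I_N0.+1) := if (a < N0)%N then nth e (enum D) a else e.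
have [Q Q0 QP] := low_rank_dependence K g (ltnSn _).
have [w Qw] := mpoly_nonvanishing infK Q0.
have gD (a : 'I_N0.+1) : (a < N0)%N -> g a \in D.
  by move=> lt_a; rewrite /g lt_a -mem_enum mem_nth // -cardE (leq_trans lt_a).
have gT (a : 'I_N0.+1) (lt_a : (a < N0)%N) : g a \in T := subsetP subDT _ (gD a lt_a).
pose val_at (v : {ffun I -> K}) (f : edge n) : K := if insub f is Some x then v x else 0.
pose var (a : 'I_N0.+1) : {mpoly K[#|{: I}|]} :=
  if (a < N0)%N then if insub (g a) is Some x then 'X_(enum_rank (x : I)) else 0 else (w
    a)%:MP.
pose P := Q \mPo [tuple var a | a < N0.+1].
have PE (v : {ffun I -> K}) : P.@[fun i => v (enum_val i)] =
    Q.@[fun a => if (a < N0)%N then val_at v (g a) else w a].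
  rewrite comp_mpoly_meval; apply: meval_eq => a; rewrite tnth_mktuple /var /val_at.
  case: ifP => _; last by rewrite mevalC.
  by case: insubP => [x _ _|_]; rewrite ?meval0 // mevalXU enum_rankK.
exists P; split.
  (* A point of [K^T] lying over the first [N0] coordinates of [w], so that [P] takes the value
     [Q.@[w]] there. *)
  pose v0 : {ffun I -> K} := [ffun x => w (inord (index (val x) (enum D)))].
  apply: contraNneq Qw => P0; have := PE v0; rewrite P0 meval0 => ->.
  apply/eqP/meval_eq => a; case: ifP => // lt_a; rewrite /val_at.
  rewrite insubT ?gT //= => gaT;
    rewrite ffunE /= /g lt_a index_uniq ?enum_uniq -?cardE ?inord_val //.
  exact: leq_trans lt_a cardD.
move=> v; rewrite PE => Pv.
pose R := mmap (@polyC K) (fun a : 'I_N0.+1 => if (a < N0)%N then (val_at v (g a))%:P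
  else 'X) Q.
have R0 : R != 0.
  apply: contraNneq Pv => R0; have := horner0 (w ord_max); rewrite -R0 horner_mmap => <-.
  apply/eqP/meval_eq => a; case: ltnP => [_|le_a]; first by rewrite hornerC.
  by rewrite hornerX; congr w; apply/val_inj/eqP; rewrite /= eqn_leq le_a -ltnS ltn_ord.
have [s sP] := poly_roots_finite R0; exists s => M [skewM rankM Mv]; apply: sP.
rewrite rootE horner_mmap -(QP M skewM rankM); apply/eqP/meval_eq => a; case: ifP => lt_a.
  by rewrite hornerC /val_at insubT ?gT //= => gaT; rewrite -Mv.
by rewrite hornerX /g lt_a.
Qed.

Lemma completions_generically_finite :
  generically (fun v : {ffun I -> K} =>
    finitely_many (fun M : 'M[K]_n => low_rank_completion k v M)).
Proof.
have [P PP] := fin_all_exists entry_generically_finite.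
apply: (generically_nonvanishing (p := \prod_e P e)) => //.
  by apply/prodf_neq0 => e _; case: (PP e).
move=> v; rewrite rmorph_prod /= => /prodf_neq0 Pv.
have [S SP] := fin_all_exists (fun e => proj2 (PP e) v (Pv e isT)).
pose s := flatten [seq S e | e <- enum {: edge n}].
apply: (finite_entries (s := 0 :: s ++ map -%R s)) => M complM i j.
have Ms e : M (src e) (tgt e) \in s.
  by apply/flattenP; exists (S e); [apply: map_f; rewrite mem_enum | apply: SP].
have [skewM _ _] := complM; rewrite inE mem_cat.
case: (ltngtP i j) => [lt_ij|lt_ji|/val_inj->]; last by rewrite skewM.2 eqxx.
  by have := Ms (Sub (i, j) lt_ij); rewrite /src /tgt /= => ->; rewrite orbT.
rewrite (skew_entry j i skewM) map_f ?orbT //.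
exact: (Ms (Sub (j, i) lt_ji)).
Qed.

End Finite.

(** * Existence of generic completions *)

Section Dominant.

Variables (K : fieldType) (n k0 : nat) (T : {set edge n}).
Let k := k0.+1.
Hypothesis closedK : GRing.closed_field_axiom K.
Hypothesis le_kn : (k <= n)%N.
Hypothesis freeT : crossing_free k.+1 T.
Local Notation I := {e : edge n | e \in T}.
Let s := #|{: I}|.
Let V := (bool * 'I_n * 'I_k)%type.

Let at_ (a : 'I_s) : edge n := val (enum_val a).

(* The unknowns of the formula are the entries of n x k matrices X (b = true)  *)
(* and Y (b = false); they are numbered after the s prescribed values.         *)
Let var b i c : GRing.term K := GRing.Var K (s + enum_rank ((b, i, c) : V)).

Let entry (a : 'I_s) : GRing.term K :=
  \big[@GRing.Add K/GRing.NatConst K 0]_(c < k)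
    GRing.Add (GRing.Mul (var true (src (at_ a)) c) (var false (tgt (at_ a)) c))
              (GRing.Opp (GRing.Mul (var false (src (at_ a)) c) (var true (tgt (at_ a))
                c))).

Let env_mx b (e : seq K) : 'M[K]_(n, k) :=
  \matrix_(i, c) e`_(s + enum_rank ((b, i, c) : V)).

Let completion (X Y : 'M[K]_(n, k)) : 'M[K]_n := X *m Y^T - Y *m X^T.

Lemma entryE e a :
  GRing.eval e (entry a) = completion (env_mx true e) (env_mx false e) (src (at_ a)) (tgt
    (at_ a)).
Proof.
rewrite /entry (big_morph (GRing.eval e) (id1 := 0) (op1 := +%R)) //.
rewrite /completion !mxE -sumrB; apply: eq_bigr => c _.
by rewrite !mxE.
Qed.

Lemma completion_low_rank X Y : skew_symmetric (completion X Y) /\ (\rank (completion X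
  Y) <= 2 * k)%N.
Proof.
split; last first.
  rewrite mul2n -addnn; apply: leq_trans (mxrank_add _ _) _; rewrite mxrank_opp.
  by apply: leq_add; apply: leq_trans (mxrankM_maxl _ _) (rank_leq_col _).
split=> [|i]; first by rewrite /completion linearB /= !trmx_mul !trmxK opprB.
by rewrite !mxE; apply/eqP; rewrite subr_eq0; apply/eqP/eq_bigr => c _; rewrite !mxE mulrC.
Qed.

(** Along a realization with leading coefficients [u], [Q] becomes a polynomial in one variable with
    leading coefficient [L.@[u]]; it is then specialized at a nonroot. *)
Lemma entries_dominant (Q : {mpoly K[s]}) : Q != 0 ->
  exists X Y, Q.@[fun a => completion X Y (src (at_ a)) (tgt (at_ a))] != 0.
Proof.
move=> Q0; have infK := closed_infinite closedK.
have [e eP] := chain_free_entries K le_kn (crossing_free_chain_free freeT).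
have [w [L [L0 LP]]] := lead_mpoly (fun a => e (src (at_ a)) (tgt (at_ a))) Q0.
(* The product of the variables forces all [u a] to be nonzero, as realizations require. *)
have LX0 : L * \prod_a 'X_a != 0.
  rewrite mulf_neq0 //; apply/prodf_neq0 => a _; apply/eqP => /(congr1 (meval (fun=> 1))).
  by rewrite mevalXU meval0; apply/eqP/oner_neq0.
have [u] := mpoly_nonvanishing infK LX0.
rewrite mevalM mulf_eq0 negb_or rmorph_prod /= => /andP[Lu /prodf_neq0 u0].
pose b i j := if [pick a | (src (at_ a) == i :> nat) && (tgt (at_ a) == j :> nat)] is Some a
              then u a else 1.
have bE a : b (src (at_ a)) (tgt (at_ a)) = u a.
  rewrite /b; case: pickP => [a' /andP[/eqP/val_inj eq_s /eqP/val_inj eq_t]|/(_ a)];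
    last by rewrite !eqxx.
  congr u; apply/enum_val_inj/val_inj/val_inj.
  by rewrite [LHS]surjective_pairing [RHS]surjective_pairing; congr (_, _).
have [|X [Y XY]] := eP b.
  by move=> i j; rewrite /b; case: pickP => [a _|_]; rewrite ?oner_neq0 //;
    have := u0 a isT; rewrite mevalXU.
pose M := X *m Y^T - Y *m X^T.
have ldM a : lead (M (src (at_ a)) (tgt (at_ a))) (e (src (at_ a)) (tgt (at_ a))) (u a).
  by rewrite -bE; apply: XY; [exact: edge_lt | rewrite edge_rel_in;
    apply: (valP (enum_val a))].
have := lead_neq0 (LP _ _ ldM) Lu => /(poly_nonroot infK)[x].
rewrite rootE horner_mmap => Mx;
  exists (map_mx (horner_eval x) X), (map_mx (horner_eval x) Y).
rewrite (meval_eq (v2 := fun a => (M (src (at_ a)) (tgt (at_ a))).[x])) // => a.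
by rewrite /completion !map_trmx -!map_mxM -map_mxB mxE.
Qed.

Lemma completion_generically_exists :
  generically (fun v : {ffun I -> K} => exists M : 'M[K]_n, low_rank_completion k v M).
Proof.
have [||Q Q0|g g0 gP] := dominant_generic closedK (N := #|{: V}|) (h := entry).
- by move=> a; apply: (big_ind (@GRing.rterm K)) => //= t1 t2 -> ->.
- move=> a e e' eq_e; rewrite !entryE; congr (completion _ _ _ _).
    by apply/matrixP => i c; rewrite !mxE; apply: eq_e; rewrite leq_addr ltn_add2l ltn_ord.
  by apply/matrixP => i c; rewrite !mxE; apply: eq_e; rewrite leq_addr ltn_add2l ltn_ord.
- have [X [Y QXY]] := entries_dominant Q0.
  exists (nseq s 0 ++ [seq (if x.1.1 then X else Y) x.1.2 x.2 | x <- enum {: V}]).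
  rewrite (meval_eq (v2 := fun a => completion X Y (src (at_ a)) (tgt (at_ a)))) // => a.
  rewrite entryE; congr (completion _ _ _ _); apply/matrixP => i c.
    rewrite mxE nth_cat size_nseq ltnNge leq_addr addKn.
    by rewrite (nth_map (true, i, c)) -?cardE ?ltn_ord // nth_enum_rank.
  rewrite mxE nth_cat size_nseq ltnNge leq_addr addKn.
  by rewrite (nth_map (false, i, c)) -?cardE ?ltn_ord // nth_enum_rank.
apply: (generically_nonvanishing (closed_infinite closedK) g0) => v /gP[e eP].
exists (completion (env_mx true e) (env_mx false e)).
have [skewM rankM] := completion_low_rank (env_mx true e) (env_mx false e).
by split=> // x; have := eP (enum_rank x); rewrite entryE /at_ enum_rankK => ->.
Qed.

End Dominant.

Theorem theorem1p8 (k n : nat) (hk : (1 <= k)%N) (hn : (2 * k + 2 <= n)%N)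
    (K : fieldType) (T : {set edge n}) :
  (crossing_free k.+1 T -> GRing.closed_field_axiom K ->
     generically (fun v : {ffun {e : edge n | e \in T} -> K} =>
       exists M : 'M[K]_n, low_rank_completion k v M))
  /\
  ((exists2 D : {set edge n}, k_triangulation k D & D \subset T) ->
     generically (fun v : {ffun {e : edge n | e \in T} -> K} =>
       finitely_many (fun M : 'M[K]_n => low_rank_completion k v M))).
Proof.
split=> [freeT closedK|[D triD subDT]].
  by case: k hk hn freeT => // k0 _ hn freeT; apply: completion_generically_exists => //;
    lia.
case: (classic (infinite K)) => [infK|finK].
  apply: (completions_generically_finite infK subDT).
  by apply: k_triangulation_card => //; lia.
(* Over a finite field there are only finitely many matrices, whatever [v] is. *)
have [s sP] : exists s : seq K, forall x, x \in s.
  apply: NNPP => no_s; apply: finK => s; apply: NNPP => no_x; apply: no_s; exists s => x.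
  by apply: contraT => xs; case: no_x; exists x.
exists (fun=> True); split=> [||v _].
- exists (eq 1) => v; split=> // _; exists 1 => //.
  by rewrite meval1 oner_neq0.
- by exists [ffun=> 0].
by apply: (finite_entries (s := s)).
Qed.
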